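(* Let $m\in\mathbb{N}$ with $m\ge2$, $0<\alpha<m$, $1<p<\infty$ and $1<p_i<\infty$ for $i=1,\ldots,m$, with $1/p=1/p_1+\cdots+1/p_m$. Then $J^m_\alpha$ maps $L^{p_1}(\mathbb{R})\times\cdots\times L^{p_m}(\mathbb{R})$ boundedly to $L^p((0,\infty),x^{pm-p\alpha}dx)$, with operator norm $$\frac{1}{\Gamma(\alpha)}\int_{0<t_1,\ldots,t_m<1}\left(\prod_{i=1}^m t_i^{-(1-1/p_i)}\right)\frac{1}{\left|\left(\frac1{t_1}-1,\ldots,\frac1{t_m}-1\right)\right|^{m-\alpha}}\,dt_1\cdots dt_m.$$
   Context: $|\cdot|$ denotes the Euclidean norm on $\mathbb{R}^m$. For complex-valued measurable functions $f_1,\ldots,f_m$ on $\mathbb{R}$ and $\vec f=(f_1,\ldots,f_m)$, the multilinear variant of the Weyl integral operator is $$J^m_\alpha\vec f(x):=\frac1{\Gamma(\alpha)}\int_{x<t_1,\ldots,t_m<\infty}\frac{\prod_{i=1}^m f_i(t_i)}{|(t_1-x,\ldots,t_m-x)|^{m-\alpha}}\,\frac{dt_1}{t_1}\cdots\frac{dt_m}{t_m},\qquad x>0.$$ The norm on $L^p((0,\infty),x^{pm-p\alpha}dx)$ is $\left(\int_0^\infty|g(x)|^px^{pm-p\alpha}\,dx\right)^{1/p}$. The operator norm of a multilinear operator $T$ from $X_1\times\cdots\times X_m$ to $Y$ is the least $C$ with $\|T(\vec f)\|_Y\le C\prod_i\|f_i\|_{X_i}$ for all $f_i\in X_i$. 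*)

(* Defs.v *)
From HB Require Import structures.
From mathcomp Require Import all_boot all_order all_algebra.
From mathcomp Require Import all_classical all_reals all_analysis.
From mathcomp Require Import complex.

Set Implicit Arguments.
Unset Strict Implicit.
Unset Printing Implicit Defensive.

Import Order.TTheory GRing.Theory Num.Theory.
Import numFieldNormedType.Exports.

Local Open Scope classical_set_scope.
Local Open Scope ring_scope.

Section cons_measure.
Context d (T : measurableType d) (R : realType).
Variables (m1 : {sigma_finite_measure set T -> \bar R}) (n : nat)
  (m2 : {sigma_finite_measure set (n.-tuple T) -> \bar R}).

Definition tuple_cons (u : T * n.-tuple T) : n.+1.-tuple T :=
  [tuple of u.1 :: u.2].

Lemma measurable_tuple_cons : measurable_fun setT tuple_cons.
Proof. exact: (measurable_cons measurable_fst measurable_snd). Qed.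

(* m1 \x m2 transported along the bijection T * T^n ~ T^(n+1). *)
Definition cons_measure : set (n.+1.-tuple T) -> \bar R :=
  pushforward (m1 \x m2)%E tuple_cons.

Let cons_measure0 : cons_measure set0 = 0%E.
Proof. by rewrite /cons_measure /pushforward preimage_set0 measure0. Qed.

Let cons_measure_ge0 A : (0 <= cons_measure A)%E.
Proof. exact: (@measure_ge0 _ _ _ (m1 \x m2)%E). Qed.

Let cons_measure_sigma_additive : semi_sigma_additive cons_measure.
Proof.
have mpre F : measurable F -> measurable (tuple_cons @^-1` F).
  by rewrite -[X in _ -> measurable X]setTI; exact: measurable_tuple_cons.
move=> F mF tF mUF; rewrite /cons_measure /pushforward preimage_bigcup.
apply: (@measure_semi_sigma_additive _ _ _ (m1 \x m2)%E).
- by move=> k; exact: mpre.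
- apply/trivIsetP => /= i j _ _ ij; rewrite -preimage_setI.
  by move/trivIsetP : tF => /(_ _ _ _ _ ij) ->//; rewrite preimage_set0.
- by rewrite -preimage_bigcup; exact: mpre.
Qed.

HB.instance Definition _ := isMeasure.Build _ _ _ cons_measure
  cons_measure0 cons_measure_ge0 cons_measure_sigma_additive.

Lemma tuple_cons_preimage (A : set T) (B : set (n.-tuple T)) :
  tuple_cons @^-1`
    [set t | A (thead t) /\ B [tuple of behead t]] = A `*` B.
Proof.
apply/seteqP; split=> -[x t] /=; rewrite theadE;
  by have -> : [tuple of behead (tuple_cons (x, t))] = t
    by apply/val_inj.
Qed.

Lemma measurable_cons_set (A : set T) (B : set (n.-tuple T)) :
  measurable A -> measurable B ->
  measurable [set t : n.+1.-tuple T | A (thead t) /\ B [tuple of behead t]].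
Proof.
move=> mA mB; apply: measurableI.
  by rewrite -[X in measurable X]setTI; exact: measurable_tnth.
by rewrite -[X in measurable X]setTI; exact: measurable_behead.
Qed.

Lemma cons_measureE (A : set T) (B : set (n.-tuple T)) :
  measurable A -> measurable B ->
  cons_measure [set t | A (thead t) /\ B [tuple of behead t]] =
  (m1 A * m2 B)%E.
Proof.
move=> mA mB.
by rewrite /cons_measure /pushforward tuple_cons_preimage product_measure1E.
Qed.

Let cons_measure_sigma_finite : sigma_finite setT cons_measure.
Proof.
have /sigma_finiteP[F [TF ndF Foo]] := sigma_finiteT m1.
have /sigma_finiteP[G [TG ndG Goo]] := sigma_finiteT m2.
exists (fun k => [set t | F k (thead t) /\ G k [tuple of behead t]]).
  apply/seteqP; split=> // t _.
  have [k _ Fk] : (\bigcup_k F k) (thead t) by rewrite -TF.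
  have [l _ Gl] : (\bigcup_k G k) [tuple of behead t] by rewrite -TG.
  exists (maxn k l) => //; split.
    by move: Fk; exact/subsetPset/ndF/leq_maxl.
  by move: Gl; exact/subsetPset/ndG/leq_maxr.
move=> k; have [mF Fk] := Foo k; have [mG Gk] := Goo k.
split; first exact: measurable_cons_set.
by rewrite cons_measureE// lte_mul_pinfty// ge0_fin_numE.
Qed.

HB.instance Definition _ := Measure_isSigmaFinite.Build _ _ _ cons_measure
  cons_measure_sigma_finite.

End cons_measure.

Section lebesgue_measure_tuple.
Variable R : realType.
Local Notation T := (measurableTypeR R).

(* Lebesgue measure on R^n; see lebesgue_tuple_box for its value on boxes. *)
Fixpoint lebesgue_tuple (n : nat) :
    {sigma_finite_measure set (n.-tuple T) -> \bar R} :=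
  match n return {sigma_finite_measure set (n.-tuple T) -> \bar R} with
  | 0 => dirac [tuple]
  | n.+1 => cons_measure lebesgue_measure (lebesgue_tuple n)
  end.

Lemma lebesgue_tuple_box n (A : 'I_n -> set R) :
  (forall i, measurable (A i : set T)) ->
  lebesgue_tuple n [set t | forall i, A i (tnth t i)] =
  (\prod_(i < n) lebesgue_measure (A i))%E.
Proof.
elim: n A => [|n IH] A mA.
  rewrite big_ord0 /= diracE mem_set//=; by case.
rewrite big_ord_recl -(IH (fun i => A (lift ord0 i)))// -cons_measureE//.
- congr (lebesgue_tuple n.+1 _); apply/seteqP; split=> t /=.
    move=> h; split=> [|i]; first exact: h.
    by have := h (lift ord0 i); rewrite [in X in X -> _](tuple_eta t) tnthS.
  move=> [h0 h] i; case: (unliftP ord0 i) => [j ->|->//].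
  by rewrite (tuple_eta t) tnthS; exact: h.
- rewrite [X in measurable X](_ : _ =
    \bigcap_(i in [set` 'I_n]) ((fun t : n.-tuple T => tnth t i) @^-1`
      A (lift ord0 i))).
    apply: fin_bigcap_measurable => // i _.
    by rewrite -[X in measurable X]setTI; exact: measurable_tnth.
  by apply/seteqP; split=> t /= h i => [_|]; exact: h.
Qed.

End lebesgue_measure_tuple.

Section weyl.
Variable R : realType.
Local Notation mu := (@lebesgue_measure R).

Definition Gamma (a : R) : R :=
  (\int[mu]_(t in `]0, +oo[) (t `^ (a - 1) * expR (- t)))%R.

Definition enorm m (v : 'I_m -> R) : R := Num.sqrt (\sum_(i < m) v i ^+ 2).

Section complex_valued.
Context d (T : measurableType d).
Variables (nu : {measure set T -> \bar R}) (D : set T).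
Implicit Type f : T -> R[i].

(* On R, measurability is Borel measurability, lebesgue_measure being defined
   on the Borel sets; every class of L^q(R) has a Borel representative. *)
Definition cmeasurable f : Prop :=
  measurable_fun D (fun x => complex.Re (f x)) /\
  measurable_fun D (fun x => complex.Im (f x)).

Definition cintegrable f : Prop :=
  nu.-integrable D (fun x => (complex.Re (f x))%:E) /\
  nu.-integrable D (fun x => (complex.Im (f x))%:E).

Definition cintegral f : R[i] :=
  Complex (\int[nu]_(x in D) complex.Re (f x))%R
          (\int[nu]_(x in D) complex.Im (f x))%R.

End complex_valued.

Definition Lp_norm (q : R) (f : R -> R[i]) : \bar R :=
  'N[mu]_(q%:E)[EFin \o (fun x => Normc.normc (f x))].

Definition in_Lp (q : R) (f : R -> R[i]) : Prop :=
  cmeasurable (setT : set (measurableTypeR R)) f /\ (Lp_norm q f < +oo)%E.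

(* The norm of L^p((0, oo), w(x) dx). *)
Definition wLp_norm (p : R) (w : R -> R) (g : R -> R[i]) : \bar R :=
  ((\int[mu]_(x in `]0%R, +oo[) ((Normc.normc (g x)) `^ p * w x)%:E)
    `^ p^-1)%E.

Definition in_wLp (p : R) (w : R -> R) (g : R -> R[i]) : Prop :=
  cmeasurable (`]0, +oo[ : set (measurableTypeR R)) g /\
  (wLp_norm p w g < +oo)%E.

Section weyl_operator.
Variables (m : nat) (alpha : R).
Local Notation Rm := (m.-tuple (measurableTypeR R)).

Definition weyl_domain (x : R) : set Rm := [set t | forall i, x < tnth t i].

Definition weyl_integrand (f : 'I_m -> R -> R[i]) (x : R) (t : Rm) : R[i] :=
  (\prod_(i < m) f i (tnth t i)) /
  real_complex R (enorm (fun i => tnth t i - x) `^ (m%:R - alpha)) *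
  real_complex R (\prod_(i < m) (tnth t i)^-1).

(* cintegral is a total function: the value is J^m_alpha f x only where the
   integrand is integrable (see cintegrable). *)
Definition weyl (f : 'I_m -> R -> R[i]) (x : R) : R[i] :=
  real_complex R (Gamma alpha)^-1 *
  cintegral (lebesgue_tuple R m) (weyl_domain x) (weyl_integrand f x).

Definition weyl_weight (p : R) (x : R) : R := x `^ (p * m%:R - p * alpha).

Definition unit_cube : set Rm := [set t | forall i, 0 < tnth t i < 1].

Definition weyl_const_integrand (ps : 'I_m -> R) (t : Rm) : R :=
  (\prod_(i < m) tnth t i `^ (- (1 - (ps i)^-1))) *
  (enorm (fun i => (tnth t i)^-1 - 1) `^ (m%:R - alpha))^-1.

Definition weyl_const (ps : 'I_m -> R) : R :=
  (Gamma alpha)^-1 *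
  (\int[lebesgue_tuple R m]_(t in unit_cube) weyl_const_integrand ps t)%R.

End weyl_operator.

(* C is a bound of T : L^(ps 0) x ... x L^(ps (m-1)) -> L^p((0, oo), w). *)
Definition is_bound m (ps : 'I_m -> R) (p : R) (w : R -> R)
    (T : ('I_m -> R -> R[i]) -> R -> R[i]) (C : R) : Prop :=
  forall f, (forall i, in_Lp (ps i) (f i)) ->
    (wLp_norm p w (T f) <= C%:E * \prod_(i < m) Lp_norm (ps i) (f i))%E.

Definition is_operator_norm m (ps : 'I_m -> R) (p : R) (w : R -> R)
    (T : ('I_m -> R -> R[i]) -> R -> R[i]) (C : R) : Prop :=
  is_bound ps p w T C /\ forall C', is_bound ps p w T C' -> C <= C'.

End weyl.

(* Main.v *)
Require Import Defs.
From mathcomp Require Import all_boot all_order all_algebra.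
From mathcomp Require Import all_classical all_reals all_analysis.
From mathcomp Require Import measurable_realfun complex.
From mathcomp Require Import ring lra.
Set Implicit Arguments.
Unset Strict Implicit.
Unset Printing Implicit Defensive.
Import Order.TTheory GRing.Theory Num.Theory.
Import numFieldNormedType.Exports.
Local Open Scope classical_set_scope.
Local Open Scope ring_scope.

(** The substitution [t_i = x / s_i], under which [dt_i / t_i] is invariant,
    turns [J f x] into [x^(alpha - m) / Gamma alpha] times the average of
    [prod_i f_i (x / s_i)] against a fixed kernel [K] on the unit cube.
    Upper bound: with [A] the integral of [K s prod_i s_i^(1/p_i)], Jensen's
    inequality for this weight moves the power [p] inside, the weighted AM-GM
    inequality with weights [p / p_i] splits the product, and each factor is
    integrated in [x] first (Tonelli), which gives [A^p prod_i |f_i|^p].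
    Sharpness: [f_i t = t^(-(1 + e)/p_i)] on [t >= 1] is homogeneous, so the
    quotient of norms is at least the integral of [K s prod_i s_i^((1 + e)/p_i)],
    which increases to [A] as [e] decreases to 0. *)

(** The mass [A] is finite because a Euclidean norm dominates each coordinate: with v_i = 1 / s_i -
    1, the power |v|^(m - alpha) is at least prod_i v_i^((m - alpha) / m), and since (m - alpha) / m
    lies strictly between 0 and 1, the majorant splits into convergent one-dimensional Beta
    integrals. The factor x^(alpha - m) comes from |x / s - x| = x |v|, and its p-th power is
    exactly what the weight x^(pm - p alpha) cancels. AM-GM is applied to p_i-th powers normalized
    by the norms, which may vanish; the estimate is therefore made with positive bounds N_i, chosen
    as norm plus d, and d tends to 0. Since [weyl] is a total function, convergence of its integral
    is a separate claim: the estimate is carried out on absolute values in the extended reals, and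
    its finiteness yields integrability for almost every x. For sharpness, the critical powers
    t^(-1/p_i) have the right homogeneity but infinite norm, whence the perturbation by e; the
    truncation at 1 is invisible from x >= 1, because x / s_i > x. *)

Section affine_change_of_variables.
Variable R : realType.
Local Notation T := (measurableTypeR R).
Local Notation mu := (@lebesgue_measure R).

(** [powR] with exponent -1 is the inverse on nonnegative reals, 0 included since both sides are 0
    there; negative reals are reached by oddness. *)
Lemma measurable_invr : measurable_fun [set: R] (fun x : R => x^-1).
Proof.
rewrite (_ : (fun x : R => x^-1) =
  (fun x : R => if 0 <= x then x `^ (-1) else - ((- x) `^ (-1)))); last first.
  apply/funext => x; case: ifPn => [x0|]; first by rewrite -powR_inv1.
  by rewrite -ltNge => x0; rewrite powR_inv1 ?oppr_ge0 ?ltW// invrN opprK.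
apply: measurable_fun_ifT.
- by apply: measurable_fun_ler.
- exact: measurable_powR.
- apply: measurable_funN.
  by apply: (measurableT_comp (measurable_powR (-1))); exact: measurable_funN.
Qed.

Lemma measurable_affine (c d : R) : measurable_fun [set: T] (fun x : T => c * x + d : T).
Proof. by apply: measurable_funD => //; exact: measurable_funM. Qed.

Section affine_measure.
Variables (c d : R).
Hypothesis c0 : 0 < c.

Let aff (x : T) : T := c * x + d.
Let maff : measurable_fun setT aff := measurable_affine c d.

Let push := measure_function_pushforward__canonical__measure_function_Measure mu maff.
Let nu := mscale (NngNum (ltW c0)) push.

Let affine_itv (a b : R) :
  aff @^-1` `]a, b]%classic = `](a - d) / c, (b - d) / c]%classic.
Proof.
apply/seteqP; split=> x /=; rewrite !in_itv/= /aff.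
  by rewrite ltr_pdivrMr// ler_pdivlMr// (mulrC x) ltrBlDr lerBrDr.
by rewrite ltr_pdivrMr// ler_pdivlMr// (mulrC x) ltrBlDr lerBrDr.
Qed.

(** Lebesgue measure is determined by its values on half-open intervals; the preimage of such an
    interval under [aff] is shorter by the factor [c], which [mscale] restores. *)
Let affine_measureE (A : set T) : measurable A -> mu A = nu A.
Proof.
apply: lebesgue_measure_unique => _ [[a b] _ /= <-].
rewrite /nu /mscale/= /pushforward affine_itv !lebesgue_measure_itv/= !lte_fin.
rewrite ltr_pM2r ?invr_gt0// ltrD2r; case: ifP => _; last by rewrite mule0.
by rewrite -!EFinB -EFinM; congr EFin; field; rewrite gt_eqF.
Qed.

Lemma ge0_integral_affine (f : T -> \bar R) : measurable_fun setT f ->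
  (forall x, 0 <= f x)%E ->
  (\int[mu]_x f x = c%:E * \int[mu]_x f (c * x + d)%R)%E.
Proof.
move=> mf f0.
rewrite (eq_measure_integral nu); last by move=> A mA _; exact: affine_measureE.
rewrite ge0_integral_mscale//; congr (_ * _)%E.
by rewrite ge0_integral_pushforward.
Qed.

End affine_measure.
End affine_change_of_variables.

(** * Invariance of the measure dt/t on the positive half-line *)

Section invariant_measure.
Variable R : realType.
Local Notation T := (measurableTypeR R).
Local Notation mu := (@lebesgue_measure R).

(** The density of dt/t, extended by 0 so that every integral against it runs over the whole
    line. *)
Definition invpos (t : R) : R := if 0 < t then t^-1 else 0.

Lemma invpos_ge0 t : 0 <= invpos t.
Proof. by rewrite /invpos; case: ifPn => // /ltW; rewrite invr_ge0. Qed.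

Lemma invposE t : 0 < t -> invpos t = t^-1.
Proof. by rewrite /invpos => ->. Qed.

Lemma measurable_invpos : measurable_fun [set: T] invpos.
Proof.
apply: measurable_fun_ifT => //; last exact: measurable_invr.
exact: measurable_fun_ltr.
Qed.

Lemma invposM c t : 0 < c -> c * invpos (c * t) = invpos t.
Proof.
move=> c0; rewrite /invpos pmulr_rgt0//; case: ifP => t0; last by rewrite mulr0.
by rewrite invfM mulrA divff ?mul1r ?gt_eqF.
Qed.

(** The Jacobian [c] of the dilation is absorbed by the density, as [invposM] states. *)
Lemma ge0_integral_scale (f : T -> \bar R) (c : R) : 0 < c ->
  measurable_fun setT f -> (forall x, 0 <= f x)%E ->
  (\int[mu]_x ((invpos x)%:E * f (c * x)%R) =
   \int[mu]_x ((invpos x)%:E * f x))%E.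
Proof.
move=> c0 mf f0.
have mi : measurable_fun [set: T] (EFin \o invpos).
  by apply/measurable_EFinP; exact: measurable_invpos.
have mc : measurable_fun [set: T] (fun x : T => c * x + 0 : T).
  exact: measurable_affine.
rewrite [RHS](@ge0_integral_affine _ c 0)//; last 2 first.
- exact: emeasurable_funM.
- by move=> x; rewrite mule_ge0// lee_fin invpos_ge0.
rewrite -ge0_integralZl//; last 3 first.
- apply: emeasurable_funM.
    by apply: (measurableT_comp mi mc).
  by apply: (measurableT_comp mf mc).
- by move=> x _; rewrite mule_ge0// lee_fin invpos_ge0.
- by rewrite lee_fin ltW.
apply: eq_integral => x _; rewrite addr0 muleA -EFinM invposM//.
Qed.

(* Uniqueness of Haar measure on (0, oo): both sides, multiplied by the
   dt/t-measure of [1, 2], equal the same double integral. *)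
Lemma ge0_integral_inv (f : T -> \bar R) :
  measurable_fun setT f -> (forall x, 0 <= f x)%E ->
  (\int[mu]_x ((invpos x)%:E * f (x^-1)%R) =
   \int[mu]_x ((invpos x)%:E * f x))%E.
Proof.
move=> mf f0.
have mi : measurable_fun [set: T] (EFin \o invpos).
  by apply/measurable_EFinP; exact: measurable_invpos.
have i0 x : (0 <= (invpos x)%:E)%E by rewrite lee_fin invpos_ge0.
pose h (x : T) : \bar R := (\1_(`[1, 2]%classic : set R) x)%:E.
have h0 x : (0 <= h x)%E by rewrite lee_fin.
have mh : measurable_fun [set: T] h.
  by apply/measurable_EFinP; exact: measurable_indic.
pose H := (\int[mu]_x ((invpos x)%:E * h x))%E.
have HE : H = (\int[mu]_(x in `[1%R, 2%R]) (invpos x)%:E)%E.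
  rewrite /H [RHS]integral_mkcond; apply: eq_integral => x _.
  rewrite /h restrict_EFin /= patchE indicE.
  by case: ifP => _; rewrite ?mule1 ?mule0.
have miI : measurable_fun (`[1%R, 2%R]%classic : set T) (EFin \o invpos).
  exact: measurable_funTS.
have Hoo : (H < +oo)%E.
  rewrite HE; apply: (@le_lt_trans _ _ (\int[mu]_(x in `[1%R, 2%R]) cst 1 x)%E).
    apply: ge0_le_integral => //= x; rewrite in_itv/= => /andP[x1 _].
    by rewrite lee_fin invposE ?(lt_le_trans ltr01)// invf_le1// (lt_le_trans ltr01).
  by rewrite integral_cst//= mul1e lebesgue_measure_itv/=; case: ifP; rewrite -?EFinB ltry.
have Hgt0 : (0 < H)%E.
  rewrite HE; apply: (@lt_le_trans _ _ (\int[mu]_(x in `[1%R, 2%R]) cst (2^-1)%:E x)%E).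
    rewrite integral_cst//= lebesgue_measure_itv/= lte_fin ltr1n -EFinB -EFinM.
    by rewrite lte_fin mulr_gt0// subr_gt0 ltr1n.
  apply: ge0_le_integral => //= x.
  rewrite in_itv/= => /andP[x1 x2]; have x0 : 0 < x by exact: lt_le_trans x1.
  by rewrite lee_fin invposE// lef_pV2 ?posrE.
set J := LHS; set I := RHS.
suff IJ : (I * H = J * H)%E.
  have Hfin : H \is a fin_num by rewrite ge0_fin_numE// ltW.
  move: IJ; rewrite -(fineK Hfin) => IJ; apply/esym.
  have Hn0 : fine H != 0 by rewrite gt_eqF// fine_gt0// Hgt0.
  have := congr1 (fun z => z * ((fine H)^-1)%:E)%E IJ.
  by rewrite -!muleA -EFinM divff// !mule1.
have m1 : measurable_fun [set: T * T] (fun z => (invpos z.1)%:E).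
  exact: (measurableT_comp mi measurable_fst).
have m2 : measurable_fun [set: T * T] (fun z => (invpos z.2)%:E).
  exact: (measurableT_comp mi measurable_snd).
have mmul : measurable_fun [set: T * T] (fun z => z.2 * z.1 : T).
  by apply: measurable_funM; [exact: measurable_snd|exact: measurable_fst].
have mdiv : measurable_fun [set: T * T] (fun z => z.1 / z.2 : T).
  apply: measurable_funM; first exact: measurable_fst.
  by apply: (measurableT_comp (@measurable_invr R)); exact: measurable_snd.
have mhc c : measurable_fun [set: T] (fun x => h (c * x)%R).
  by apply: (measurableT_comp mh); exact: measurable_funM.
(* The double integral of [f t * h (u * t)] against dt/t du/u. For fixed [t > 0], dilating [u] by
   [t] makes the inner integral [H]. In the other order, dilating [t] by [u] gives
   [f (t / u) * h t], and after a second exchange the integral of [f (t / u)] in [u] is [J], again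
   by a dilation. *)
transitivity (\int[mu]_t \int[mu]_u
    ((invpos t)%:E * f t * ((invpos u)%:E * h (u * t)%R)))%E.
  rewrite muleC /I -ge0_integralZl//; last 3 first.
  - exact: emeasurable_funM.
  - by move=> x _; rewrite mule_ge0.
  - exact: ltW.
  apply: eq_integral => t _; have [t0|t0] := ltP 0 t; last first.
    have -> : invpos t = 0 by rewrite /invpos ltNge t0.
    by rewrite mul0e mule0; under eq_integral do rewrite mul0e; rewrite integral0.
  rewrite ge0_integralZl//; last 3 first.
  - apply: emeasurable_funM => //.
    by apply: (measurableT_comp mh); exact: measurable_funM.
  - by move=> x _; rewrite mule_ge0.
  - by rewrite mule_ge0.
  rewrite muleC; congr (_ * _)%E.
  by under eq_integral do rewrite mulrC; rewrite ge0_integral_scale.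
rewrite (fubini_tonelli (fun z : T * T => (invpos z.1)%:E * f z.1 *
    ((invpos z.2)%:E * h (z.2 * z.1)%R))%E); last 2 first.
- apply: emeasurable_funM; apply: emeasurable_funM => //.
    exact: (measurableT_comp mf measurable_fst).
  exact: (measurableT_comp mh mmul).
- by move=> z; rewrite !mule_ge0.
transitivity (\int[mu]_u \int[mu]_t
    ((invpos u)%:E * ((invpos t)%:E * (f (t / u)%R * h t))))%E.
  apply: eq_integral => u _ /=; have [u0|u0] := ltP 0 u; last first.
    have -> : invpos u = 0 by rewrite /invpos ltNge u0.
    under eq_integral do rewrite mul0e mule0.
    by under [in RHS]eq_integral do rewrite mul0e.
  have mfu : measurable_fun [set: T] (fun t => f (t / u)%R).
    by apply: (measurableT_comp mf); exact: measurable_funM.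
  rewrite [RHS]ge0_integralZl//; last 2 first.
  - by apply: emeasurable_funM => //; apply: emeasurable_funM.
  - by move=> x _; rewrite !mule_ge0.
  rewrite -(@ge0_integral_scale (fun t => f (t / u)%R * h t)%E u)//; last 2 first.
  - by apply: emeasurable_funM.
  - by move=> x; rewrite mule_ge0.
  rewrite -ge0_integralZl//; last 2 first.
  - apply: emeasurable_funM => //; apply: emeasurable_funM => //.
    by apply: (measurableT_comp mfu); exact: measurable_funM.
  - by move=> x _; rewrite !mule_ge0.
  apply: eq_integral => t _.
  rewrite [(u * t / u)%R]mulrC mulKf ?gt_eqF//.
  by rewrite muleCA -muleA.
rewrite -(fubini_tonelli (fun z : T * T => (invpos z.2)%:E * ((invpos z.1)%:E *
    (f (z.1 / z.2)%R * h z.1)))%E); last 2 first.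
- apply: emeasurable_funM => //; apply: emeasurable_funM => //.
  apply: emeasurable_funM; first exact: (measurableT_comp mf mdiv).
  exact: (measurableT_comp mh measurable_fst).
- by move=> z; rewrite !mule_ge0.
have mfV : measurable_fun [set: T] (fun x => f x^-1%R).
  exact: (measurableT_comp mf (@measurable_invr R)).
rewrite /H -ge0_integralZl//; last 3 first.
- exact: emeasurable_funM.
- by move=> x _; rewrite mule_ge0.
- by apply: integral_ge0 => x _; rewrite mule_ge0.
apply: eq_integral => t _ /=; have [t0|t0] := ltP 0 t; last first.
  have -> : invpos t = 0 by rewrite /invpos ltNge t0.
  under eq_integral do rewrite mul0e mule0.
  by rewrite mul0e mule0 integral0.
under eq_integral do rewrite muleA muleACA muleC.
rewrite ge0_integralZl//; last 3 first.
- apply: emeasurable_funM => //; apply: (measurableT_comp mf).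
  by apply: measurable_funM => //; exact: measurable_invr.
- by move=> x _; rewrite mule_ge0.
- by rewrite mule_ge0.
rewrite muleC; congr (_ * _)%E.
rewrite /J -(@ge0_integral_scale (fun x => f x^-1%R) t^-1) ?invr_gt0//.
by apply: eq_integral => u _; rewrite invfM invrK mulrC.
Qed.

Lemma ge0_integral_scale_inv (f : T -> \bar R) (c : R) : 0 < c ->
  measurable_fun setT f -> (forall x, 0 <= f x)%E ->
  (\int[mu]_x ((invpos x)%:E * f (c / x)%R) =
   \int[mu]_x ((invpos x)%:E * f x))%E.
Proof.
move=> c0 mf f0.
rewrite (@ge0_integral_inv (fun x => f (c * x)%R))//.
  exact: ge0_integral_scale.
by apply: (measurableT_comp mf); exact: measurable_funM.
Qed.

End invariant_measure.

(** * Iterated integrals over tuples and the product of the measures dt_i/t_i *)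

Section tuple_integral.
Variable R : realType.
Local Notation T := (measurableTypeR R).
Local Notation mu := (@lebesgue_measure R).
Local Notation leb := (lebesgue_tuple R).

Lemma ge0_integral_tuple0 (F : 0.-tuple T -> \bar R) : measurable_fun setT F ->
  (\int[leb 0]_t F t = F [tuple])%E.
Proof. by move=> mF; rewrite /= integral_dirac// diracT mul1e. Qed.

(** By construction [lebesgue_tuple n.+1] is the image of a product measure under [tuple_cons], so
    Tonelli applies after pulling back. Both inductions on the dimension below rest on this. *)
Lemma ge0_integral_tupleS n (F : n.+1.-tuple T -> \bar R) :
  measurable_fun setT F -> (forall t, 0 <= F t)%E ->
  (\int[leb n.+1]_t F t =
   \int[mu]_x \int[leb n]_t F (tuple_cons (x, t)))%E.
Proof.
move=> mF F0.
have mc := @measurable_tuple_cons _ T n.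
transitivity (\int[(mu \x leb n)]_z F (tuple_cons z))%E.
  have := @ge0_integral_pushforward _ _ _ _ R _ mc (mu \x leb n)%E setT F
    measurableT mF (fun x _ => F0 x).
  rewrite preimage_setT => <-.
  by apply: eq_measure_integral => A mA _.
rewrite fubini_tonelli1//.
exact: (measurableT_comp mF mc).
Qed.

Lemma measurable_tuple_cons_r n (x : T) :
  measurable_fun setT (fun t : n.-tuple T => tuple_cons (x, t)).
Proof.
apply: (measurableT_comp (@measurable_tuple_cons _ T n)).
by apply: measurable_fun_pair => //; exact: measurable_id.
Qed.

Lemma measurable_map_tuple n (phi : T -> T) : measurable_fun setT phi ->
  measurable_fun setT (fun t : n.-tuple T => map_tuple phi t).
Proof.
move=> mphi; apply/measurable_fun_tnthP => i.
apply: (eq_measurable_fun (fun t : n.-tuple T => phi (tnth t i))).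
  by move=> t _ /=; rewrite tnth_map.
exact: (measurableT_comp mphi (measurable_tnth i)).
Qed.

Lemma measurable_prod_tnth n (g : 'I_n -> T -> R) :
  (forall i, measurable_fun setT (g i)) ->
  measurable_fun setT (fun t : n.-tuple T => \prod_(i < n) g i (tnth t i)).
Proof.
move=> mg; apply: measurable_prod => i _.
exact: (measurableT_comp (mg i) (measurable_tnth i)).
Qed.

Lemma prod_tuple_cons n (g : 'I_n.+1 -> T -> R) (x : T) (t : n.-tuple T) :
  \prod_(i < n.+1) g i (tnth (tuple_cons (x, t)) i) =
  g ord0 x * \prod_(i < n) g (lift ord0 i) (tnth t i).
Proof.
rewrite big_ord_recl; congr (_ * _).
apply: eq_bigr => i _; congr (g _ _).
by rewrite [tuple_cons _](_ : _ = [tuple of x :: t]) ?tnthS//; apply/val_inj.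
Qed.

Lemma ge0_integral_tuple_prod n (g : 'I_n -> T -> R) :
  (forall i, measurable_fun setT (g i)) -> (forall i x, 0 <= g i x) ->
  (\int[leb n]_t (\prod_(i < n) g i (tnth t i))%:E =
   \prod_(i < n) \int[mu]_x (g i x)%:E)%E.
Proof.
elim: n g => [|n IH] g mg g0.
  rewrite ge0_integral_tuple0; first by rewrite !big_ord0.
  by apply/measurable_EFinP; exact: measurable_prod_tnth.
have P0 k (h : 'I_k -> T -> R) (h0 : forall i x, 0 <= h i x) t :
    (0 <= (\prod_(i < k) h i (tnth t i))%:E)%E.
  by rewrite lee_fin prodr_ge0.
have mP k (h : 'I_k -> T -> R) (mh : forall i, measurable_fun setT (h i)) :
    measurable_fun setT (fun t : k.-tuple T => (\prod_(i < k) h i (tnth t i))%:E).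
  by apply/measurable_EFinP; exact: measurable_prod_tnth.
rewrite ge0_integral_tupleS; [|exact: (mP _ g mg)|exact: (P0 _ g g0)].
rewrite big_ord_recl -(IH (fun i => g (lift ord0 i)))//.
rewrite muleC -ge0_integralZl//; last 3 first.
- exact/measurable_EFinP.
- by move=> x _; rewrite lee_fin.
- by apply: integral_ge0 => t _; apply: (P0 _ (fun i => g (lift ord0 i))).
apply: eq_integral => x _.
under eq_integral do rewrite prod_tuple_cons EFinM.
rewrite ge0_integralZl ?lee_fin//; first by rewrite muleC.
- by apply: (mP _ (fun i => g (lift ord0 i))).
- by move=> t _; apply: (P0 _ (fun i => g (lift ord0 i))).
Qed.

(** The density of the product of the measures dt_i/t_i, supported on the positive orthant. *)
Definition tuple_invpos n (t : n.-tuple T) : R := \prod_(i < n) invpos (tnth t i).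

Lemma tuple_invpos_ge0 n (t : n.-tuple T) : 0 <= tuple_invpos t.
Proof. by rewrite prodr_ge0// => i _; exact: invpos_ge0. Qed.

Lemma measurable_tuple_invpos n :
  measurable_fun setT (fun t : n.-tuple T => (tuple_invpos t)%:E).
Proof.
apply/measurable_EFinP; apply: (measurable_prod_tnth (g := fun=> @invpos R)) => _.
exact: measurable_invpos.
Qed.

(** One coordinate at a time: for a fixed head the induction hypothesis substitutes in the tail, and
    the one-dimensional invariance then substitutes in the head. The function [G] of the head is the
    integral over the tail, whose measurability comes from Tonelli. *)
Lemma ge0_integral_tuple_scale_inv n (F : n.-tuple T -> \bar R) (c : R) : 0 < c ->
  measurable_fun setT F -> (forall t, 0 <= F t)%E ->
  (\int[leb n]_t ((tuple_invpos t)%:E * F (map_tuple (fun x => c / x)%R t)) =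
   \int[leb n]_t ((tuple_invpos t)%:E * F t))%E.
Proof.
move=> c0.
have mdiv : measurable_fun [set: T] (fun x : T => c / x : T).
  by apply: measurable_funM => //; exact: measurable_invr.
elim: n F => [|n IH] F mF F0.
  have mF' : measurable_fun setT (fun t => (tuple_invpos t)%:E * F t)%E.
    by apply: emeasurable_funM => //; exact: measurable_tuple_invpos.
  rewrite !ge0_integral_tuple0//.
    by congr (_ * F _)%E; apply/val_inj.
  apply: emeasurable_funM; first exact: measurable_tuple_invpos.
  exact: (measurableT_comp mF (measurable_map_tuple mdiv)).
have w0 k (t : k.-tuple T) : (0 <= (tuple_invpos t)%:E)%E.
  by rewrite lee_fin tuple_invpos_ge0.
have i0 x : (0 <= (@invpos R x)%:E)%E by rewrite lee_fin invpos_ge0.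
have WS x (t : n.-tuple T) :
    (tuple_invpos (tuple_cons (x, t)))%:E = ((invpos x)%:E * (tuple_invpos t)%:E)%E.
  by rewrite /tuple_invpos (prod_tuple_cons (fun=> @invpos R)) EFinM.
have mFx x : measurable_fun setT (fun t : n.-tuple T => F (tuple_cons (x, t))).
  exact: (measurableT_comp mF (measurable_tuple_cons_r x)).
have mW k := @measurable_tuple_invpos k.
have mG : measurable_fun setT (fun t : n.+1.-tuple T => (tuple_invpos t)%:E * F t)%E.
  exact: (emeasurable_funM (mW _) mF).
pose G (x : T) := (\int[leb n]_t ((tuple_invpos t)%:E * F (tuple_cons (x, t))))%E.
have G0 x : (0 <= G x)%E by apply: integral_ge0 => t _; rewrite mule_ge0.
have mGG : measurable_fun setT G.
  apply: (measurable_fun_fubini_tonelli_F (fun z : T * n.-tuple T =>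
    (tuple_invpos z.2)%:E * F (tuple_cons z))%E) => [|z]; last by rewrite mule_ge0.
  apply: emeasurable_funM; first exact: (measurableT_comp (mW n) measurable_snd).
  exact: (measurableT_comp mF (@measurable_tuple_cons _ T n)).
rewrite !ge0_integral_tupleS//; last 3 first.
- by move=> t; rewrite mule_ge0.
- apply: (emeasurable_funM (mW _)).
  exact: (measurableT_comp mF (measurable_map_tuple mdiv)).
- by move=> t; rewrite mule_ge0.
transitivity (\int[mu]_x ((invpos x)%:E * G (c / x)%R))%E.
  apply: eq_integral => x _.
  under eq_integral => t _.
    rewrite WS -muleA (_ : map_tuple _ _ =
      tuple_cons (c / x, map_tuple (fun x => c / x) t)%R).
    over.
    by apply/val_inj.
  rewrite ge0_integralZl//; last 2 first.
  - apply: (emeasurable_funM (mW _)).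
    exact: (measurableT_comp (mFx _) (measurable_map_tuple mdiv)).
  - by move=> t _; rewrite mule_ge0.
  by rewrite (IH (fun t => F (tuple_cons (c / x, t))) (mFx _) (fun=> F0 _)).
rewrite ge0_integral_scale_inv//.
apply: eq_integral => x _.
under [RHS]eq_integral do rewrite WS -muleA.
rewrite ge0_integralZl//.
  exact: (emeasurable_funM (mW _) (mFx _)).
by move=> t _; rewrite mule_ge0.
Qed.

End tuple_integral.

(** * Integrals of powers and the one-dimensional factor of the kernel's majorant *)

Section power_integrals.
Variable R : realType.
Local Notation T := (measurableTypeR R).
Local Notation mu := (@lebesgue_measure R).

Lemma cvg_powRN_pinfty (a : R) : 0 < a -> (x `^ (- a) @[x --> +oo] --> 0).
Proof.
move=> a0; apply/cvgrPdist_lt => e e0; near=> x.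
have x0 : 0 < x by near: x; exact: nbhs_pinfty_gt.
rewrite sub0r normrN ger0_norm ?powR_ge0// powRN -[e]invrK.
rewrite ltf_pV2 ?posrE ?invr_gt0 ?powR_gt0//.
rewrite -[ltLHS]powRr1 ?invr_ge0 ?ltW// -[X in _ `^ X < _](mulVf (lt0r_neq0 a0)).
rewrite powRrM; apply: gt0_ltr_powR => //.
- by rewrite nnegrE powR_ge0.
- by rewrite nnegrE ltW.
Unshelve. all: by end_near. Qed.

Lemma integral_powR_1y (a : R) : 0 < a ->
  (\int[mu]_(x in `[1%R, +oo[) (x `^ (- 1 - a))%:E = (a^-1)%:E)%E.
Proof.
move=> a0.
have dF (x : R) : 0 < x ->
    is_derive x 1 (fun x : R => - a^-1 * x `^ (- a)) (x `^ (- 1 - a)).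
  move=> x0; have D := is_derive1_powR (- a) x0.
  apply: is_derive_eq.
  by rewrite /GRing.scale/= mulrA mulrNN mulVf ?gt_eqF// mul1r addrC.
rewrite (@ge0_continuous_FTC2y _ _ (fun x => - a^-1 * x `^ (- a)) 1 0).
- by rewrite powR1 mulr1 -EFinB sub0r opprK.
- by move=> x _; exact: powR_ge0.
- apply: continuous_in_subspaceT => x; rewrite inE/= in_itv/= andbT => x1.
  have [d _] := is_derive1_powR (- 1 - a) (lt_le_trans ltr01 x1).
  exact: (differentiable_continuous (proj1 (derivable1_diffP _ _) d)).
- rewrite -[X in _ --> X](mulr0 (- a^-1)).
  by apply: cvgM; [exact: cvg_cst|exact: cvg_powRN_pinfty].
- by move=> x x1; have [] := dF _ (lt_trans ltr01 x1).
- apply: cvg_at_right_filter.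
  have [d _] := dF 1 ltr01.
  exact: (differentiable_continuous (proj1 (derivable1_diffP _ _) d)).
- move=> x; rewrite in_itv/= andbT => x1.
  by rewrite derive1E; have [_ ->] := dF _ (lt_trans ltr01 x1).
Qed.

Lemma itv_indicE (i : interval R) (x : R) :
  \1_([set` i] : set R) x = (x \in i)%:R :> R.
Proof. by rewrite indicE mem_setE. Qed.

Lemma integral_invpos_powR_1y (a : R) : 0 < a ->
  (\int[mu]_x ((invpos x)%:E * (\1_(`[1, +oo[%classic : set R) x * x `^ (- a))%:E)
   = (a^-1)%:E)%E.
Proof.
move=> a0; rewrite -integral_powR_1y// [RHS]integral_mkcond.
apply: eq_integral => x _; rewrite patchE mem_setE itv_indicE.
case: ifPn => [|_]; last by rewrite mul0r mule0.
rewrite in_itv/= andbT => x1; have x0 := lt_le_trans ltr01 x1.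
rewrite mul1r -EFinM invposE// powRD; last by rewrite (gt_eqF x0) implybT.
by rewrite powR_inv1// ltW.
Qed.

(** The inversion x -> 1/x exchanges (0, 1] and [1, oo) and preserves dx/x, so the previous integral
    is recovered. *)
Lemma integral_invpos_powR_01 (a : R) : 0 < a ->
  (\int[mu]_x ((invpos x)%:E * (\1_(`]0, 1]%classic : set R) x * x `^ a)%:E)
   = (a^-1)%:E)%E.
Proof.
move=> a0; rewrite -integral_invpos_powR_1y//.
rewrite -[RHS]ge0_integral_inv; last 2 first.
- apply/measurable_EFinP; apply: measurable_funM.
    exact: measurable_indic.
  exact: measurable_powR.
- by move=> x; rewrite lee_fin mulr_ge0// powR_ge0.
apply: eq_integral => x _; have [x0|x0] := ltP 0 x; last first.
  by rewrite /invpos ltNge x0 !mul0e.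
congr (_ * (_ * _)%:E)%E; last by rewrite -powR_inv1 ?ltW// -powRrM mulN1r opprK.
by rewrite !itv_indicE !in_itv/= x0 andbT invf_ge1.
Qed.

(** Substituting s = 1/v and then v = u + 1 turns this into the integral of (u + 1)^(-1 - b) u^(-c)
    over u > 0, the Beta integral B(1 - c, b + c). Only finiteness matters: the integrand is at most
    u^(-c) on (0, 1], integrable as c < 1, and at most u^(-1 - c) beyond 1, integrable as c > 0;
    these are [g1] and [g2]. *)
Lemma integral_cube_factor_lty (b c : R) : 0 < b -> 0 < c -> c < 1 ->
  (\int[mu]_s (invpos s * (\1_(`]0, 1[%classic : set R) s *
     (s `^ b * (s^-1 - 1) `^ (- c))))%:E < +oo)%E.
Proof.
move=> b0 c0 c1.
pose f (s : T) : R := \1_(`]1, +oo[%classic : set R) s *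
  ((s^-1) `^ b * (s - 1) `^ (- c)).
have f0 x : 0 <= f x by rewrite mulr_ge0// mulr_ge0// powR_ge0.
have mf : measurable_fun setT f.
  apply: measurable_funM; first exact: measurable_indic.
  apply: measurable_funM.
    exact: (measurableT_comp (measurable_powR _) (@measurable_invr R)).
  by apply: (measurableT_comp (measurable_powR _)); exact: measurable_funB.
rewrite (eq_integral (fun s : T => (invpos s)%:E * (f s^-1)%:E)%E); last first.
  move=> s _; rewrite -EFinM; congr EFin.
  have [s0|s0] := ltP 0 s; last by rewrite /invpos ltNge s0 !mul0r.
  rewrite /f invrK; congr (_ * (_ * _)).
  by rewrite !itv_indicE !in_itv/= s0 andbT/= invf_gt1.
rewrite (@ge0_integral_inv _ (EFin \o f)); last 2 first.
- exact/measurable_EFinP.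
- by move=> x; rewrite lee_fin.
have mi : measurable_fun [set: T] (@invpos R) by exact: measurable_invpos.
rewrite (@ge0_integral_affine _ 1 1)//; last 2 first.
- by apply: emeasurable_funM; exact/measurable_EFinP.
- by move=> x; rewrite /= mule_ge0// lee_fin ?invpos_ge0.
rewrite mul1e.
pose g1 (u : T) := ((invpos u)%:E * (\1_(`]0, 1]%classic : set R) u * u `^ (1 - c))%:E)%E.
pose g2 (u : T) := ((invpos u)%:E * (\1_(`[1, +oo[%classic : set R) u * u `^ (- c))%:E)%E.
have mg a (A : set T) : measurable A ->
    measurable_fun setT (fun u : T => (invpos u)%:E * (\1_A u * u `^ a)%:E)%E.
  move=> mA; apply: emeasurable_funM; apply/measurable_EFinP => //.
  by apply: measurable_funM; [exact: measurable_indic|exact: measurable_powR].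
have g10 u : (0 <= g1 u)%E by rewrite mule_ge0// lee_fin ?invpos_ge0// mulr_ge0// powR_ge0.
have g20 u : (0 <= g2 u)%E by rewrite mule_ge0// lee_fin ?invpos_ge0// mulr_ge0// powR_ge0.
apply: (@le_lt_trans _ _ (\int[mu]_u (g1 u + g2 u))%E); last first.
  rewrite ge0_integralD//; [|exact: mg..].
  rewrite integral_invpos_powR_01 ?subr_gt0// integral_invpos_powR_1y//.
  by rewrite -EFinD ltry.
have ma : measurable_fun [set: T] (fun x : T => 1 * x + 1 : T) by exact: measurable_affine.
apply: ge0_le_integral => //=.
- by move=> x _; rewrite /= mule_ge0// lee_fin ?invpos_ge0.
- apply: emeasurable_funM; apply/measurable_EFinP.
    exact: (measurableT_comp mi ma).
  exact: (measurableT_comp mf ma).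
- by apply: emeasurable_funD; exact: mg.
move=> u _; rewrite mul1r /f addrK itv_indicE in_itv/= andbT ltrDr.
have [u0|u0] := ltP 0 u; last by rewrite mul0r mule0 adde_ge0.
have u10 : 0 < u + 1 by rewrite addr_gt0.
rewrite mul1r invposE//.
have hb : (u + 1)^-1 `^ b <= 1.
  rewrite [leRHS](_ : 1 = 1 `^ b); last by rewrite powR1.
  apply: ge0_ler_powR; rewrite ?nnegrE ?invr_ge0//; try exact: ltW.
  by rewrite invf_le1// lerDr ltW.
have hc : 0 <= u `^ (- c) by exact: powR_ge0.
have [u1|u1] := leP u 1.
  apply: (@le_trans _ _ (g1 u)); last by rewrite leeDl.
  rewrite /g1 itv_indicE in_itv/= u0 u1 mul1r -!EFinM lee_fin invposE//.
  rewrite powRD; last by rewrite (gt_eqF u0) implybT.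
  rewrite powRr1 ?(ltW u0)// mulKf ?(gt_eqF u0)// mulrA; apply: ler_piMl => //.
  apply: mulr_ile1 => //; [by rewrite invr_ge0 ltW|exact: powR_ge0|].
  by rewrite invf_le1// lerDr ltW.
apply: (@le_trans _ _ (g2 u)); last by rewrite leeDr.
rewrite /g2 itv_indicE in_itv/= (ltW u1) mul1r -!EFinM lee_fin invposE//.
apply: ler_pM; rewrite ?invr_ge0 ?mulr_ge0 ?powR_ge0 ?(ltW u10)//.
  by rewrite lef_pV2 ?posrE// lerDl.
exact: ler_piMl.
Qed.

End power_integrals.

(** * Weighted AM-GM, bounds for the Euclidean norm, and Jensen's inequality *)

Section inequalities.
Variable R : realType.
Implicit Types x y r : R.

Lemma powR_prod n (x : 'I_n -> R) r : (forall i, 0 <= x i) ->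
  (\prod_(i < n) x i) `^ r = \prod_(i < n) x i `^ r.
Proof.
move=> x0; elim: n x x0 => [|n IH] x x0; first by rewrite !big_ord0 powR1.
by rewrite !big_ord_recl powRM// ?IH// prodr_ge0.
Qed.

Lemma prod_powR_sum n (w : 'I_n -> R) x : 0 < x ->
  \prod_(i < n) x `^ w i = x `^ (\sum_(i < n) w i).
Proof.
move=> x0; elim: n w => [|n IH] w; first by rewrite !big_ord0 powRr0.
by rewrite !big_ord_recl IH powRD// (gt_eqF x0) implybT.
Qed.

(* With M = sum_i w_i x_i, multiply the bounds x_i <= M exp(x_i / M - 1). *)
Lemma weighted_amgm n (w x : 'I_n -> R) : (forall i, 0 <= w i) ->
  \sum_(i < n) w i = 1 -> (forall i, 0 <= x i) ->
  \prod_(i < n) x i `^ w i <= \sum_(i < n) w i * x i.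
Proof.
move=> w0 w1 x0; apply/ler_addgt0Pl => e e0.
(* Here [M] also contains the slack [e > 0]: the weighted sum alone may vanish, and the argument
   divides by [M]. *)
set M := _ + _.
have M0 : 0 < M by rewrite ltr_pwDl// sumr_ge0// => i _; rewrite mulr_ge0.
apply: (@le_trans _ _ (\prod_(i < n) (M * expR (x i / M - 1)) `^ w i)).
  apply: ler_prod => i _; rewrite powR_ge0/=.
  apply: ge0_ler_powR; rewrite ?nnegrE// ?mulr_ge0 ?expR_ge0 ?(ltW M0)//.
  rewrite mulrC -ler_pdivrMr//.
  by apply: le_trans (expR_ge1Dx _); rewrite addrC subrK.
have -> : \prod_(i < n) (M * expR (x i / M - 1)) `^ w i =
    M * expR (\sum_(i < n) (x i / M - 1) * w i).
  have MM : M = \prod_(i < n) M `^ w i by rewrite prod_powR_sum// w1 powRr1 ?ltW.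
  rewrite expR_sum [X in _ = X * _]MM -big_split/=; apply: eq_bigr => i _.
  by rewrite powRM ?expR_ge0 ?(ltW M0)// -expRM.
rewrite ler_piMr ?(ltW M0)// -[leRHS]expR0 ler_expR.
under eq_bigr do rewrite mulrBl mul1r.
rewrite big_split/= sumrN w1 subr_le0.
rewrite (eq_bigr (fun i => (w i * x i) * M^-1)); last by move=> i _; rewrite mulrC mulrA.
by rewrite -mulr_suml ler_pdivrMr// mul1r /M lerDr ltW.
Qed.

(** Each coordinate is at most the norm, and [n * r] is split evenly among the [n] coordinates. This
    decouples the variables of the kernel. *)
Lemma prod_le_enorm n (v : 'I_n -> R) r : 0 <= r -> (0 < n)%N ->
  (forall i, 0 < v i) ->
  \prod_(i < n) v i `^ r <= enorm v `^ (n%:R * r).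
Proof.
case: n v => // n v r0 _ v0.
have le i : v i <= enorm v.
  rewrite -(ger0_norm (ltW (v0 i))) -sqrtr_sqr; apply: ler_wsqrtr.
  by rewrite (bigD1 i)//= lerDl sumr_ge0// => j _; rewrite sqr_ge0.
have N0 : 0 < enorm v by exact: lt_le_trans (le ord0).
rewrite (_ : _ * r = \sum_(i < n.+1) r); last first.
  by rewrite sumr_const card_ord mulr_natl.
rewrite -prod_powR_sum//; apply: ler_prod => i _; rewrite powR_ge0/=.
by apply: ge0_ler_powR; rewrite ?nnegrE ?(ltW (v0 i)) ?(ltW N0).
Qed.

Lemma enorm_gt0 n (v : 'I_n -> R) : (0 < n)%N -> (forall i, 0 < v i) -> 0 < enorm v.
Proof.
case: n v => // n v _ v0; rewrite /enorm sqrtr_gt0 big_ord_recl.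
by rewrite ltr_pwDl ?exprn_gt0// sumr_ge0// => j _; rewrite sqr_ge0.
Qed.

Lemma enormZ n (v : 'I_n -> R) x : 0 <= x ->
  enorm (fun i => x * v i) = x * enorm v.
Proof.
move=> x0; rewrite /enorm; under eq_bigr do rewrite exprMn.
by rewrite -mulr_sumr sqrtrM ?sqr_ge0// sqrtr_sqr ger0_norm.
Qed.

Lemma measurable_enorm d (X : measurableType d) n (v : 'I_n -> X -> R) D :
  (forall i, measurable_fun D (v i)) ->
  measurable_fun D (fun x : X => enorm (fun i => v i x)).
Proof.
move=> mv.
apply: (eq_measurable_fun (fun x : X => (\sum_(i < n) v i x ^+ 2) `^ 2^-1)).
  by move=> x _; rewrite powR12_sqrt// sumr_ge0// => i _; rewrite sqr_ge0.
apply: (measurableT_comp (measurable_powR _)).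
apply: measurable_sum => i; exact: measurable_funX.
Qed.

(** Hoelder's inequality for [u * k^(1/p)] and [k^(1/q)], raised to the power [p]: the second factor
    contributes the mass of [k] to the power p/q = p - 1. Keeping this power avoids normalizing [k]
    to a probability density. *)
Lemma ge0_jensen_powR d (X : measurableType d) (nu : {measure set X -> \bar R})
    (u k : X -> R) (p A : R) : 1 < p -> 0 <= A ->
  measurable_fun setT u -> measurable_fun setT k ->
  (forall x : X, 0 <= u x) -> (forall x : X, 0 <= k x) ->
  (\int[nu]_x (k x)%:E <= A%:E)%E ->
  ((\int[nu]_x (u x * k x)%:E) `^ p <=
   (A `^ (p - 1))%:E * \int[nu]_x (u x `^ p * k x)%:E)%E.
Proof.
move=> p1 A0 mu mk u0 k0 kA.
have p0 : 0 < p by exact: lt_trans p1.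
have pn0 := gt_eqF p0.
pose q := p / (p - 1).
have p10 : 0 < p - 1 by rewrite subr_gt0.
have q0 : 0 < q by rewrite divr_gt0.
have pq : p^-1 + q^-1 = 1 by rewrite /q; field; rewrite pn0 gt_eqF.
have mkr r : measurable_fun setT (fun x : X => k x `^ r).
  exact: (measurableT_comp (measurable_powR _) mk).
have := @hoelder _ _ _ nu (fun x : X => u x * k x `^ p^-1) (fun x : X => k x `^ q^-1)
  p q (measurable_funM mu (mkr _)) (mkr _) p0 q0 pq.
rewrite Lnorm1.
rewrite (eq_integral (fun x : X => (u x * k x)%:E)); last first.
  move=> x _ /=.
  rewrite ger0_norm ?mulr_ge0 ?powR_ge0// -mulrA -powRD ?pq ?powRr1//.
  by rewrite oner_eq0.
move=> H.
have B0 : (0 <= \int[nu]_x (u x `^ p * k x)%:E)%E.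
  by apply: integral_ge0 => x _; rewrite lee_fin mulr_ge0// powR_ge0.
have K0 : (0 <= \int[nu]_x (k x)%:E)%E.
  by apply: integral_ge0 => x _; rewrite lee_fin.
have Np : ('N[nu]_(p%:E)[EFin \o (fun x : X => u x * k x `^ p^-1)%R])%E =
    ((\int[nu]_x (u x `^ p * k x)%:E) `^ p^-1)%E.
  rewrite unlock; congr (_ `^ _)%E; apply: eq_integral => x _ /=.
  rewrite ger0_norm ?mulr_ge0 ?powR_ge0// powRM ?powR_ge0//.
  by rewrite -powRrM mulVf ?pn0// powRr1.
have Nq : ('N[nu]_(q%:E)[EFin \o (fun x : X => k x `^ q^-1)%R])%E =
    ((\int[nu]_x (k x)%:E) `^ q^-1)%E.
  rewrite unlock; congr (_ `^ _)%E; apply: eq_integral => x _ /=.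
  by rewrite ger0_norm ?powR_ge0// -powRrM mulVf ?gt_eqF// powRr1.
have I0 : (0 <= \int[nu]_x (u x * k x)%:E)%E.
  by apply: integral_ge0 => x _; rewrite lee_fin mulr_ge0.
have nn (z : \bar R) : (0 <= z)%E -> z \in `[0%E, +oo%E].
  by move=> z0; rewrite in_itv/= z0 leey.
apply: (@le_trans _ _
    (((\int[nu]_x (u x `^ p * k x)%:E) `^ p^-1 * (A%:E) `^ q^-1) `^ p)%E).
  apply: gt0_ler_poweR; [exact: ltW|exact: nn| |].
    by apply: nn; rewrite mule_ge0// poweR_ge0.
  apply: (le_trans H); rewrite Np Nq lee_wpmul2l ?poweR_ge0//.
  by apply: gt0_ler_poweR; rewrite ?nn ?invr_ge0 ?(ltW q0)// lee_fin.
rewrite poweRM ?poweR_ge0// -!poweRrM mulVf ?pn0// poweRe1// muleC.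
rewrite (_ : q^-1 * p = p - 1) ?poweR_EFin//.
by rewrite /q; field; rewrite pn0 gt_eqF.
Qed.

End inequalities.

(** * The kernel on the unit cube and the finiteness of the constant *)

Section weyl_kernel.
Variables (R : realType) (m : nat) (alpha : R).
Local Notation T := (measurableTypeR R).
Local Notation Rm := (m.-tuple T).
Local Notation mu := (@lebesgue_measure R).
Local Notation leb := (lebesgue_tuple R m).

(* With t_i = x / s_i, the integrand of the Weyl operator at x becomes
   x^(alpha - m) (prod_i f_i (x / s_i)) weyl_kernel s. *)
Definition weyl_kernel (s : Rm) : R :=
  \1_(@unit_cube R m) s * tuple_invpos s *
  (enorm (fun i => (tnth s i)^-1 - 1) `^ (m%:R - alpha))^-1.

Lemma measurable_tnth_set (A : set T) : measurable A ->
  measurable [set t : Rm | forall i, A (tnth t i)].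
Proof.
move=> mA.
rewrite [X in measurable X](_ : _ =
    \bigcap_(i in [set` 'I_m]) ((fun t : Rm => tnth t i) @^-1` A)).
  apply: fin_bigcap_measurable => // i _.
  by rewrite -[X in measurable X]setTI; exact: measurable_tnth.
by apply/seteqP; split=> t /= h i => [_|]; exact: h.
Qed.

Lemma measurable_unit_cube : measurable (@unit_cube R m : set Rm).
Proof.
rewrite (_ : @unit_cube R m = [set t : Rm | forall i, `]0, 1[%classic (tnth t i)]).
  by apply: (@measurable_tnth_set `]0, 1[%classic).
by apply/seteqP; split=> t /= h i; have := h i; rewrite in_itv.
Qed.

Lemma measurable_weyl_domain x : measurable (@weyl_domain R m x : set Rm).
Proof.
rewrite (_ : @weyl_domain R m x = [set t : Rm | forall i, `]x, +oo[%classic (tnth t i)]).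
  by apply: (@measurable_tnth_set `]x, +oo[%classic).
by apply/seteqP; split=> t /= h i; have := h i; rewrite in_itv/= andbT.
Qed.

Lemma weyl_kernel_ge0 s : 0 <= weyl_kernel s.
Proof. by rewrite !mulr_ge0 ?invr_ge0 ?powR_ge0 ?tuple_invpos_ge0. Qed.

Lemma weyl_kernel_out s : ~ unit_cube s -> weyl_kernel s = 0.
Proof. by move=> h; rewrite /weyl_kernel indicE memNset// !mul0r. Qed.

Lemma measurable_tnthR (i : 'I_m) : measurable_fun setT (fun s : Rm => tnth s i : R).
Proof. exact: measurable_tnth. Qed.

Lemma measurable_inv_enorm : measurable_fun setT (fun s : Rm =>
  (enorm (fun i => (tnth s i)^-1 - 1) `^ (m%:R - alpha))^-1).
Proof.
apply: (measurableT_comp (@measurable_invr R)).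
apply: (measurableT_comp (measurable_powR _)).
apply: measurable_enorm => i; apply: measurable_funB => //.
exact: (measurableT_comp (@measurable_invr R) (measurable_tnthR i)).
Qed.

Lemma measurable_weyl_kernel : measurable_fun setT weyl_kernel.
Proof.
apply: measurable_funM; last exact: measurable_inv_enorm.
apply: measurable_funM.
  by apply: measurable_indic; exact: measurable_unit_cube.
by apply/measurable_EFinP; exact: measurable_tuple_invpos.
Qed.

Lemma measurable_prod_powR (b : 'I_m -> R) :
  measurable_fun setT (fun s : Rm => \prod_(i < m) tnth s i `^ b i).
Proof.
apply: (measurable_prod_tnth (g := fun i x => x `^ b i)) => i.
exact: measurable_powR.
Qed.

Lemma prod_powR_ge0 (b : 'I_m -> R) (s : Rm) : 0 <= \prod_(i < m) tnth s i `^ b i.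
Proof. by rewrite prodr_ge0// => i _; exact: powR_ge0. Qed.

(** On the cube, the factor 1/s_i contained in [tuple_invpos] combines with s_i^(1/p_i) into
    s_i^(-(1 - 1/p_i)). *)
Lemma weyl_kernel_prodE (ps : 'I_m -> R) s :
  weyl_kernel s * \prod_(i < m) tnth s i `^ (ps i)^-1 =
  \1_(@unit_cube R m) s * weyl_const_integrand alpha ps s.
Proof.
have [cs|cs] := pselect (unit_cube s); last first.
  by rewrite weyl_kernel_out// indicE memNset// !mul0r.
rewrite /weyl_kernel /weyl_const_integrand -!mulrA; congr (_ * _).
rewrite [X in _ * X]mulrC mulrA; congr (_ * _).
rewrite /tuple_invpos -big_split/=; apply: eq_bigr => i _.
have /andP[s0 _] := cs i.
rewrite opprB [_ - 1]addrC powRD; last by rewrite (gt_eqF s0) implybT.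
by rewrite powR_inv1 ?(ltW s0)// invposE.
Qed.

Hypotheses (m0 : (0 < m)%N) (alpha0 : 0 < alpha) (alpham : alpha < m%:R).

(** With [beta = (m - alpha) / m], [prod_le_enorm] bounds the inverse power of the norm by a product
    of functions of single coordinates, and [integral_cube_factor_lty] applies because 0 < alpha < m
    puts [beta] strictly between 0 and 1. General exponents [b] serve both 1/p_i and the perturbed
    (1 + e)/p_i. *)
Lemma weyl_kernel_lty (b : 'I_m -> R) : (forall i, 0 < b i) ->
  (\int[leb]_s (weyl_kernel s * \prod_(i < m) tnth s i `^ b i)%:E < +oo)%E.
Proof.
move=> b0.
have m0R : 0 < m%:R :> R by rewrite ltr0n.
pose beta := (m%:R - alpha) / m%:R.
have beta0 : 0 < beta by rewrite divr_gt0// subr_gt0.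
have beta1 : beta < 1 by rewrite ltr_pdivrMr// mul1r gtrBl.
pose g (i : 'I_m) (s : T) : R := invpos s * (\1_(`]0, 1[%classic : set R) s *
  (s `^ b i * (s^-1 - 1) `^ (- beta))).
have g0 i s : 0 <= g i s by rewrite /g !mulr_ge0 ?invpos_ge0 ?powR_ge0.
have mg i : measurable_fun setT (g i).
  apply: measurable_funM; first exact: measurable_invpos.
  apply: measurable_funM; first exact: measurable_indic.
  apply: measurable_funM; first exact: measurable_powR.
  apply: (measurableT_comp (measurable_powR _)).
  by apply: measurable_funB => //; exact: measurable_invr.
apply: (@le_lt_trans _ _ (\int[leb]_s (\prod_(i < m) g i (tnth s i))%:E)%E); last first.
  rewrite ge0_integral_tuple_prod//.
  rewrite ltey_eq; apply/orP; left.
  elim/big_ind : _ => // [x y|i _]; first exact: fin_numM.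
  rewrite ge0_fin_numE; first exact: integral_cube_factor_lty.
  by apply: integral_ge0 => s _; rewrite lee_fin.
apply: ge0_le_integral => //=.
- by move=> s _; rewrite lee_fin mulr_ge0// ?weyl_kernel_ge0 ?prod_powR_ge0.
- apply/measurable_EFinP; apply: measurable_funM.
    exact: measurable_weyl_kernel.
  exact: measurable_prod_powR.
- by apply/measurable_EFinP; exact: measurable_prod_tnth.
move=> s _; rewrite lee_fin.
have [cs|cs] := pselect (unit_cube s); last first.
  by rewrite weyl_kernel_out// mul0r prodr_ge0.
have s0 i : 0 < tnth s i by have /andP[] := cs i.
have v0 i : 0 < (tnth s i)^-1 - 1.
  by rewrite subr_gt0 invf_gt1//; have /andP[] := cs i.
rewrite /g !big_split/= /weyl_kernel indicE mem_set// mul1r -!mulrA.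
rewrite ler_wpM2l ?tuple_invpos_ge0//.
rewrite [X in _ <= X * _]big1 ?mul1r; last first.
  by move=> i _; rewrite itv_indicE in_itv/=; have -> := cs i.
rewrite mulrC ler_wpM2l ?prod_powR_ge0//.
under eq_bigr do rewrite powRN.
rewrite prodfV lef_pV2 ?posrE ?powR_gt0 ?enorm_gt0//; last first.
  by apply: prodr_gt0 => i _; rewrite powR_gt0.
rewrite (_ : m%:R - alpha = m%:R * beta).
  by apply: prod_le_enorm => //; exact: ltW.
by rewrite /beta mulrCA divff ?mulr1// gt_eqF.
Qed.

Variable ps : 'I_m -> R.
Hypothesis ps1 : forall i, 1 < ps i.

Lemma weyl_const_integrable :
  leb.-integrable (@unit_cube R m) (fun t => (weyl_const_integrand alpha ps t)%:E).
Proof.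
have w0 t : 0 <= weyl_const_integrand alpha ps t.
  by rewrite mulr_ge0 ?prod_powR_ge0 ?invr_ge0 ?powR_ge0.
apply/integrableP; split.
  apply: measurable_funTS; apply/measurable_EFinP.
  by apply: measurable_funM; [exact: measurable_prod_powR|exact: measurable_inv_enorm].
have ps0 i : 0 < (ps i)^-1 by rewrite invr_gt0 (lt_trans ltr01).
apply: le_lt_trans (weyl_kernel_lty ps0).
rewrite integral_mkcond le_eqVlt; apply/orP; left; apply/eqP.
apply: eq_integral => t _; rewrite weyl_kernel_prodE patchE indicE.
by case: ifP => _; rewrite ?mul0r// mul1r gee0_abs ?lee_fin.
Qed.

Lemma weyl_constE : weyl_const alpha ps = (Gamma alpha)^-1 *
  fine (\int[leb]_s (weyl_kernel s * \prod_(i < m) tnth s i `^ (ps i)^-1)%:E)%E.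
Proof.
rewrite /weyl_const /Rintegral integral_mkcond; congr (_ * fine _).
apply: eq_integral => t _; rewrite weyl_kernel_prodE patchE indicE.
by case: ifP => _; rewrite ?mul0r// mul1r.
Qed.

End weyl_kernel.

(** * The upper bound for the kernel average of nonnegative functions *)

Section weyl_mean.
Variables (R : realType) (m : nat) (alpha : R).
Local Notation T := (measurableTypeR R).
Local Notation Rm := (m.-tuple T).
Local Notation mu := (@lebesgue_measure R).
Local Notation leb := (lebesgue_tuple R m).
Local Notation kernel := (@weyl_kernel R m alpha).

(** Meant for g_i = |f_i| and valued in the extended reals, so that it makes sense before any
    convergence is known. *)
Definition weyl_mean (g : 'I_m -> R -> R) (x : R) : \bar R :=
  (\int[leb]_s (kernel s * \prod_(i < m) g i (x / tnth s i)%R)%:E)%E.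

Section measurability.
Variables (g : 'I_m -> R -> R).
Hypothesis mg : forall i, measurable_fun [set: T] (g i).
Hypothesis g0 : forall i x, 0 <= g i x.

Lemma weyl_mean_ge0 x : (0 <= weyl_mean g x)%E.
Proof.
apply: integral_ge0 => s _; rewrite lee_fin mulr_ge0 ?weyl_kernel_ge0//.
by rewrite prodr_ge0.
Qed.

Lemma measurable_dilate i :
  measurable_fun [set: T * Rm] (fun z => g i (z.1 / tnth z.2 i) : R).
Proof.
apply: (measurableT_comp (mg i)); apply: measurable_funM.
  exact: measurable_fst.
apply: (measurableT_comp (@measurable_invr R)).
exact: (measurableT_comp (measurable_tnth i) measurable_snd).
Qed.

Lemma measurable_mean_integrand : measurable_fun [set: T * Rm]
  (fun z => (kernel z.2 * \prod_(i < m) g i (z.1 / tnth z.2 i))%:E).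
Proof.
apply/measurable_EFinP; apply: measurable_funM.
  exact: (measurableT_comp (@measurable_weyl_kernel R m alpha) measurable_snd).
by apply: measurable_prod => i _; exact: measurable_dilate.
Qed.

Lemma measurable_weyl_mean : measurable_fun [set: T] (weyl_mean g).
Proof.
apply: (measurable_fun_fubini_tonelli_F (fun z : T * Rm =>
  (kernel z.2 * \prod_(i < m) g i (z.1 / tnth z.2 i))%:E)) => [|z].
  exact: measurable_mean_integrand.
by rewrite lee_fin mulr_ge0 ?weyl_kernel_ge0// prodr_ge0.
Qed.

End measurability.

Hypotheses (m0 : (0 < m)%N) (alpha0 : 0 < alpha) (alpham : alpha < m%:R).
Variables (p : R) (ps : 'I_m -> R).
Hypotheses (p1 : 1 < p) (ps1 : forall i, 1 < ps i)
  (pps : p^-1 = \sum_(i < m) (ps i)^-1).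

(** The weight for Jensen's inequality; its mass [A] is the desired constant up to the factor
    1/Gamma(alpha). *)
Let k (s : Rm) : R := kernel s * \prod_(i < m) tnth s i `^ (ps i)^-1.
Let A : R := fine (\int[leb]_s (k s)%:E)%E.

Let p0 : 0 < p. Proof. exact: lt_trans p1. Qed.
Let ps0 i : 0 < ps i. Proof. exact: lt_trans (ps1 i). Qed.
Let k0 s : 0 <= k s.
Proof. by rewrite mulr_ge0 ?weyl_kernel_ge0 ?prod_powR_ge0. Qed.
Let mk : measurable_fun setT k.
Proof.
by apply: measurable_funM; [exact: measurable_weyl_kernel|exact: measurable_prod_powR].
Qed.
Let AE : (\int[leb]_s (k s)%:E)%E = A%:E.
Proof.
rewrite /A fineK// ge0_fin_numE; last by apply: integral_ge0 => s _; rewrite lee_fin.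
by apply: weyl_kernel_lty => // i; rewrite invr_gt0.
Qed.
Let A0 : 0 <= A.
Proof. by rewrite -lee_fin -AE; apply: integral_ge0 => s _; rewrite lee_fin. Qed.

Section bound.
Variables (g : 'I_m -> R -> R) (N : 'I_m -> R).
Hypothesis mg : forall i, measurable_fun [set: T] (g i).
Hypothesis g0 : forall i x, 0 <= g i x.
Hypothesis N0 : forall i, 0 < N i.
Hypothesis gN : forall i, (\int[mu]_x (g i x `^ ps i)%:E <= (N i `^ ps i)%:E)%E.

Let B : R := (\prod_(i < m) N i) `^ p.
(** The i-th summand of AM-GM, with weight p/p_i. The factor 1/s_i compensates the Jacobian of x ->
    x/s_i, and dividing by N_i^p_i normalizes: on the cube its integral in x is at most p/p_i. The
    constant [B] restores the removed factors. *)
Let term (z : T * Rm) i : R :=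
  p / ps i * (g i (z.1 / tnth z.2 i) `^ ps i * invpos (tnth z.2 i) / N i `^ ps i).
Let H (z : T * Rm) : R := k z.2 * \sum_(i < m) term z i.

Let term0 z i : 0 <= term z i.
Proof.
by rewrite /term !mulr_ge0 ?invr_ge0 ?powR_ge0 ?invpos_ge0 ?(ltW p0) ?(ltW (ps0 i)).
Qed.

Let H0 z : 0 <= H z. Proof. by rewrite mulr_ge0// sumr_ge0. Qed.

Let mterm i : measurable_fun setT (term ^~ i).
Proof.
apply: measurable_funM => //; apply: measurable_funM => //; apply: measurable_funM.
  by apply: (measurableT_comp (measurable_powR _)); exact: measurable_dilate.
apply: (measurableT_comp (@measurable_invpos R)).
exact: (measurableT_comp (measurable_tnth i) measurable_snd).
Qed.

Let mH : measurable_fun setT H.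
Proof.
apply: measurable_funM; first exact: (measurableT_comp mk measurable_snd).
by apply: measurable_sum => i; exact: mterm.
Qed.

Let w1 : \sum_(i < m) p / ps i = 1.
Proof. by rewrite -mulr_sumr -pps divff// gt_eqF. Qed.

(** Multiplying and dividing by s_i^(1/p_i) writes the integrand of the mean as [u * k]. Jensen's
    inequality for the weight [k] leaves [u^p], which equals [B] times the product of the
    y_i^(p/p_i), and AM-GM bounds that product by the sum of the terms. *)
Let mean_powR_le x : 0 < x ->
  ((weyl_mean g x) `^ p <= (A `^ (p - 1) * B)%:E * \int[leb]_s (H (x, s))%:E)%E.
Proof.
move=> x0.
pose u (s : Rm) : R := \prod_(i < m) (g i (x / tnth s i) * tnth s i `^ (- (ps i)^-1)).
have u0 s : 0 <= u s.
  by rewrite prodr_ge0// => i _; rewrite mulr_ge0 ?powR_ge0.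
have mpair : measurable_fun setT (fun s : Rm => (x, s) : T * Rm).
  by apply: measurable_fun_pair => //; exact: measurable_id.
have mu' : measurable_fun setT u.
  apply: measurable_prod => i _; apply: measurable_funM.
    exact: (measurableT_comp (measurable_dilate mg i) mpair).
  exact: (measurableT_comp (measurable_powR _) (measurable_tnthR i)).
have meanE : weyl_mean g x = (\int[leb]_s (u s * k s)%:E)%E.
  apply: eq_integral => s _; congr EFin.
  have [cs|cs] := pselect (unit_cube s); last first.
    by rewrite /k weyl_kernel_out// !(mul0r, mulr0).
  rewrite /k /u mulrCA; congr (_ * _); rewrite -big_split/=.
  apply: eq_bigr => i _; have /andP[s0 _] := cs i.
  by rewrite powRN mulfVK// gt_eqF// powR_gt0.
rewrite meanE; apply: le_trans (ge0_jensen_powR p1 A0 mu' mk u0 k0 _) _.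
  by rewrite AE.
rewrite EFinM -muleA lee_wpmul2l ?lee_fin ?powR_ge0//.
have mHx : measurable_fun setT (fun s : Rm => (H (x, s))%:E).
  by apply/measurable_EFinP; exact: (measurableT_comp mH mpair).
rewrite -ge0_integralZl//; last 2 first.
- by move=> s _; rewrite lee_fin.
- by rewrite lee_fin powR_ge0.
apply: ge0_le_integral => //=.
- by move=> s _; rewrite lee_fin mulr_ge0 ?powR_ge0.
- apply/measurable_EFinP; apply: measurable_funM => //.
  exact: (measurableT_comp (measurable_powR _) mu').
- exact: measurable_funeM.
move=> s _; rewrite -EFinM lee_fin /H/=.
have [cs|cs] := pselect (unit_cube s); last first.
  by rewrite /k weyl_kernel_out// !(mul0r, mulr0).
rewrite (mulrC _ (k s)) (mulrCA B (k s)); apply: ler_wpM2l => //.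
have s0 i : 0 < tnth s i by have /andP[] := cs i.
pose y i := g i (x / tnth s i) `^ ps i * invpos (tnth s i) / N i `^ ps i.
have y0 i : 0 <= y i by rewrite /y !mulr_ge0 ?invr_ge0 ?powR_ge0 ?invpos_ge0.
have wge0 i : 0 <= p / ps i by rewrite divr_ge0 ?(ltW p0) ?(ltW (ps0 i)).
apply: (@le_trans _ _ (B * \prod_(i < m) y i `^ (p / ps i))); last first.
  by apply: ler_wpM2l; [exact: powR_ge0|exact: weighted_amgm].
rewrite le_eqVlt; apply/orP; left; apply/eqP.
rewrite /B /u !powR_prod; [|by move=> i; exact: ltW|
  by move=> i; rewrite mulr_ge0 ?powR_ge0].
rewrite -big_split/=; apply: eq_bigr => i _.
rewrite /y invposE// !powRM ?mulr_ge0 ?invr_ge0 ?powR_ge0 ?(ltW (s0 i))//.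
have psn0 : ps i != 0 by rewrite gt_eqF.
rewrite -[(tnth s i)^-1]powR_inv1 ?(ltW (s0 i))//.
rewrite -[(N i `^ ps i)^-1]powR_inv1 ?powR_ge0// -!powRrM.
have -> : ps i * (p / ps i) = p by field.
have -> : ps i * (-1 * (p / ps i)) = - p by field.
have -> : - (ps i)^-1 * p = -1 * (p / ps i) by field.
by rewrite [RHS]mulrCA -(@powRD _ (N i)) ?subrr ?powRr0 ?mulr1 ?(gt_eqF (N0 i)) ?implybT.
Qed.

(** After Tonelli, for each s in the cube the x-integral of the sum of terms is at most the sum of
    the p/p_i, which is 1. What remains is the mass [A] of [k], which completes A^(p - 1) to A^p. *)
Lemma weyl_mean_bound :
  (\int[mu]_(x in `]0%R, +oo[) ((weyl_mean g x) `^ p) <= (A `^ p * B)%:E)%E.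
Proof.
have c0 : 0 <= A `^ (p - 1) * B by rewrite mulr_ge0 ?powR_ge0.
have mHF : measurable_fun setT (fun x : T => \int[leb]_s (H (x, s))%:E)%E.
  apply: (measurable_fun_fubini_tonelli_F (fun z : T * Rm => (H z)%:E)) => [|z].
    exact/measurable_EFinP.
  by rewrite lee_fin.
have HF0 x : (0 <= \int[leb]_s (H (x, s))%:E)%E.
  by apply: integral_ge0 => s _; rewrite lee_fin.
apply: (@le_trans _ _ (\int[mu]_(x in `]0%R, +oo[)
    ((A `^ (p - 1) * B)%:E * \int[leb]_s (H (x, s))%:E))%E).
  apply: ge0_le_integral => //=.
  - by move=> x _; exact: poweR_ge0.
  - apply: measurable_funTS.
    exact: (measurableT_comp (measurable_poweR _) (measurable_weyl_mean mg g0)).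
  - by apply: measurable_funTS; exact: measurable_funeM.
  - by move=> x; rewrite in_itv/= andbT => x0; exact: mean_powR_le.
(* Enlarging the half-line to the whole line lets each dilation x -> x/s_i be an affine change of
   variables without boundary. *)
apply: (@le_trans _ _ (\int[mu]_x
    ((A `^ (p - 1) * B)%:E * \int[leb]_s (H (x, s))%:E))%E).
  apply: ge0_subset_integral => //; first exact: measurable_funeM.
  by move=> x _; rewrite mule_ge0.
rewrite ge0_integralZl//.
have -> : A `^ p * B = A `^ (p - 1) * B * A.
  rewrite mulrAC; congr (_ * _).
  (* Adding exponents of [powR] requires a nonzero base, so [A = 0] is settled apart, where both
     sides are 0. *)
  have [->|An0] := eqVneq A 0.
    by rewrite mulr0 powR0// gt_eqF.
  by rewrite -{3}(powRr1 A0) -powRD ?subrK// An0 implybT.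
rewrite [leRHS]EFinM lee_wpmul2l ?lee_fin//.
rewrite (fubini_tonelli (fun z : T * Rm => (H z)%:E)); last 2 first.
- exact/measurable_EFinP.
- by move=> z; rewrite lee_fin.
rewrite -AE; apply: ge0_le_integral => //=.
- by move=> s _; apply: integral_ge0 => x _; rewrite lee_fin.
- apply: (measurable_fun_fubini_tonelli_G (fun z : T * Rm => (H z)%:E)) => [|z].
    exact/measurable_EFinP.
  by rewrite lee_fin.
- exact/measurable_EFinP.
move=> s _.
have [cs|cs] := pselect (unit_cube s); last first.
  under eq_integral do rewrite /H/= /k weyl_kernel_out// !mul0r.
  by rewrite integral0 lee_fin.
have mpair : measurable_fun setT (fun x : T => (x, s) : T * Rm).
  by apply: measurable_fun_pair => //; exact: measurable_id.
have mtx i : measurable_fun setT (fun x : T => (term (x, s) i)%:E).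
  by apply/measurable_EFinP; exact: (measurableT_comp (mterm i) mpair).
rewrite (eq_integral (fun x : T =>
    (k s)%:E * \sum_(i < m) (term (x, s) i)%:E)%E); last first.
  by move=> x _; rewrite sumEFin -EFinM.
rewrite ge0_integralZl//; last 3 first.
- by apply: emeasurable_sum => i; exact: mtx.
- by move=> x _; rewrite sume_ge0// => i _; rewrite lee_fin.
- by rewrite lee_fin.
rewrite -[leRHS]mule1 lee_wpmul2l ?lee_fin//.
rewrite ge0_integral_sum//; last by move=> i x _; rewrite lee_fin.
rewrite -w1 -sumEFin; apply: lee_sum => i _.
have /andP[s0 _] := cs i.
rewrite /term/=.
have c1 : 0 <= p / ps i * (invpos (tnth s i) / N i `^ ps i).
  by rewrite !mulr_ge0 ?invr_ge0 ?powR_ge0 ?invpos_ge0 ?(ltW p0) ?(ltW (ps0 i)).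
rewrite (eq_integral (fun x : T => (p / ps i * (invpos (tnth s i) / N i `^ ps i))%:E
  * (g i (x / tnth s i) `^ ps i)%:E)%E); last first.
  by move=> x _; rewrite -EFinM; congr EFin; ring.
have mgi : measurable_fun setT (fun x : T => (g i x `^ ps i)%:E).
  by apply/measurable_EFinP; exact: (measurableT_comp (measurable_powR _) (mg i)).
have mdil : measurable_fun setT (fun x : T => x / tnth s i : T).
  exact: measurable_funM.
rewrite ge0_integralZl//; last 2 first.
- exact: (measurableT_comp mgi mdil).
- by move=> x _; rewrite lee_fin powR_ge0.
have sV0 : 0 < (tnth s i)^-1 by rewrite invr_gt0.
have gaff := @ge0_integral_affine R _ 0 sV0 _ mgi (fun x => powR_ge0 _ _).
have gE : (\int[mu]_x (g i (x / tnth s i) `^ ps i)%:E =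
    (tnth s i)%:E * \int[mu]_x (g i x `^ ps i)%:E)%E.
  rewrite gaff muleA -EFinM divff ?gt_eqF// mul1e.
  by apply: eq_integral => x _; rewrite addr0 mulrC.
rewrite gE.
apply: (@le_trans _ _ ((p / ps i * (invpos (tnth s i) / N i `^ ps i))%:E *
    ((tnth s i)%:E * (N i `^ ps i)%:E))%E).
  by rewrite lee_wpmul2l// ?lee_fin// lee_wpmul2l ?lee_fin ?(ltW s0).
rewrite -!EFinM lee_fin invposE// le_eqVlt; apply/orP; left; apply/eqP.
by field; rewrite !gt_eqF ?powR_gt0.
Qed.

End bound.
End weyl_mean.

(** * Complex-valued functions: modulus, measurability, triangle inequality for integrals *)

Section complex_valued.
Context (R : realType) d (X : measurableType d).
Implicit Types (f : X -> R[i]) (D : set X) (z : R[i]).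

Lemma normcE z : Normc.normc z = Num.sqrt (complex.Re z ^+ 2 + complex.Im z ^+ 2).
Proof. by case: z. Qed.

Lemma normc_ge0 z : 0 <= Normc.normc z.
Proof. by rewrite normcE sqrtr_ge0. Qed.

Lemma ler_Re_normc z : `|complex.Re z| <= Normc.normc z.
Proof. by rewrite normcE -sqrtr_sqr ler_wsqrtr// lerDl sqr_ge0. Qed.

Lemma ler_Im_normc z : `|complex.Im z| <= Normc.normc z.
Proof. by rewrite normcE -sqrtr_sqr ler_wsqrtr// lerDr sqr_ge0. Qed.

Lemma normc_real (r : R) : Normc.normc (real_complex R r) = `|r|.
Proof. by rewrite normcE/= expr0n/= addr0 sqrtr_sqr. Qed.

Lemma normc_prod n (F : 'I_n -> R[i]) :
  Normc.normc (\prod_(i < n) F i) = \prod_(i < n) Normc.normc (F i).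
Proof.
elim: n F => [|n IH] F; first by rewrite !big_ord0 Normc.normc1.
by rewrite !big_ord_recl Normc.normcM IH.
Qed.

Lemma real_complexV (r : R) : (real_complex R r)^-1 = real_complex R r^-1.
Proof. by rewrite fmorphV. Qed.

Lemma cmeasurableM D (f g : X -> R[i]) : cmeasurable D f -> cmeasurable D g ->
  cmeasurable D (fun x => f x * g x).
Proof.
move=> [mf1 mf2] [mg1 mg2]; split.
  apply: (eq_measurable_fun (fun x => complex.Re (f x) * complex.Re (g x) -
    complex.Im (f x) * complex.Im (g x))).
    by move=> x _; case: (f x) (g x) => a b [].
  by apply: measurable_funB; apply: measurable_funM.
apply: (eq_measurable_fun (fun x => complex.Re (f x) * complex.Im (g x) +
    complex.Im (f x) * complex.Re (g x))).
  by move=> x _; case: (f x) (g x) => a b [].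
by apply: measurable_funD; apply: measurable_funM.
Qed.

Lemma cmeasurable_prod D n (F : 'I_n -> X -> R[i]) :
  (forall i, cmeasurable D (F i)) -> cmeasurable D (fun x => \prod_(i < n) F i x).
Proof.
elim: n F => [|n IH] F mF.
  rewrite (_ : (fun x => _) = (fun=> 1)); last first.
    by apply/funext => x; rewrite big_ord0.
  by split; exact: measurable_cst.
rewrite (_ : (fun x => _) =
  (fun x => F ord0 x * \prod_(i < n) F (lift ord0 i) x)); last first.
  by apply/funext => x; rewrite big_ord_recl.
by apply: cmeasurableM => //; exact: IH.
Qed.

Lemma cmeasurable_real D (r : X -> R) : measurable_fun D r ->
  cmeasurable D (fun x => real_complex R (r x)).
Proof. by move=> mr; split => //; exact: measurable_cst. Qed.

Lemma measurable_normc D f : cmeasurable D f ->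
  measurable_fun D (fun x => Normc.normc (f x)).
Proof.
move=> [mf1 mf2].
apply: (eq_measurable_fun
    (fun x => (complex.Re (f x) ^+ 2 + complex.Im (f x) ^+ 2) `^ 2^-1)).
  by move=> x _; rewrite powR12_sqrt ?normcE// addr_ge0 ?sqr_ge0.
apply: (measurableT_comp (measurable_powR _)).
by apply: measurable_funD; exact: measurable_funX.
Qed.

Lemma cintegrable_normc (nu : {measure set X -> \bar R}) D f : measurable D ->
  cmeasurable D f -> (\int[nu]_(x in D) (Normc.normc (f x))%:E < +oo)%E ->
  cintegrable nu D f.
Proof.
move=> mD mf foo.
have fi : nu.-integrable D (fun x => (Normc.normc (f x))%:E).
  apply/integrableP; split; first by apply/measurable_EFinP; exact: measurable_normc.
  by under eq_integral do rewrite gee0_abs ?lee_fin ?normc_ge0//.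
split; apply: (le_integrable mD _ _ fi).
- by apply/measurable_EFinP; exact: mf.1.
- by move=> x _; rewrite /= lee_fin (ger0_norm (normc_ge0 _)) ler_Re_normc.
- by apply/measurable_EFinP; exact: mf.2.
- by move=> x _; rewrite /= lee_fin (ger0_norm (normc_ge0 _)) ler_Im_normc.
Qed.

(* Integrate Re (conj w * f) <= |w| |f| where w is the integral of f. *)
Lemma le_normc_cintegral (nu : {measure set X -> \bar R}) D f : measurable D ->
  cmeasurable D f ->
  ((Normc.normc (cintegral nu D f))%:E <=
   \int[nu]_(x in D) (Normc.normc (f x))%:E)%E.
Proof.
move=> mD mf.
have [foo|] := ltP (\int[nu]_(x in D) (Normc.normc (f x))%:E)%E +oo%E; last first.
  by rewrite leye_eq => /eqP ->; rewrite leey.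
have [fR fI] := cintegrable_normc mD mf foo.
have fi : nu.-integrable D (fun x => (Normc.normc (f x))%:E).
  apply/integrableP; split; first by apply/measurable_EFinP; exact: measurable_normc.
  by under eq_integral do rewrite gee0_abs ?lee_fin ?normc_ge0//.
have I0 : (0 <= \int[nu]_(x in D) (Normc.normc (f x))%:E)%E.
  by apply: integral_ge0 => x _; rewrite lee_fin normc_ge0.
rewrite -[leRHS]fineK ?ge0_fin_numE// lee_fin.
rewrite -/(Rintegral nu D (fun x => Normc.normc (f x))).
set w := cintegral _ _ _; set N := Normc.normc w.
have N0 : 0 <= N by exact: normc_ge0.
have [->|Nn0] := eqVneq N 0.
  by apply: Rintegral_ge0 => x _; exact: normc_ge0.
have Npos : 0 < N by rewrite lt_neqAle eq_sym Nn0.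
rewrite -(ler_pM2l Npos) -RintegralZl//.
have -> : N * N = \int[nu]_(x in D)
    (complex.Re w * complex.Re (f x) + complex.Im w * complex.Im (f x)).
  rewrite RintegralD//; last 2 first.
  - exact: (integrableZl mD (complex.Re w) fR).
  - exact: (integrableZl mD (complex.Im w) fI).
  rewrite !RintegralZl// -expr2 /N normcE sqr_sqrtr ?addr_ge0 ?sqr_ge0//.
apply: le_Rintegral => //.
- exact: (integrableD mD (integrableZl mD (complex.Re w) fR)
    (integrableZl mD (complex.Im w) fI)).
- exact: (integrableZl mD N fi).
move=> x _; rewrite /N !normcE -sqrtrM ?addr_ge0 ?sqr_ge0//.
apply: le_trans (ler_norm _) _; rewrite -sqrtr_sqr ler_wsqrtr//.
(* Lagrange's identity in the plane: |w|^2 |f|^2 minus the squared inner product is the squared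
   determinant. *)
rewrite -subr_ge0 (_ : _ - _ =
  (complex.Re w * complex.Im (f x) - complex.Im w * complex.Re (f x)) ^+ 2).
  exact: sqr_ge0.
ring.
Qed.

End complex_valued.

(** Tonelli gives the measurability of the integrals of the positive and negative parts; their
    difference is measurable also where it reads +oo - +oo. This generality suits [weyl], which has
    a value even at points where its integrand is not integrable. *)
Lemma measurable_partial_integral (R : realType) d1 d2 (X : measurableType d1)
    (Y : measurableType d2) (nu : {sigma_finite_measure set Y -> \bar R})
    (h : X * Y -> \bar R) : measurable_fun setT h ->
  measurable_fun setT (fun x => \int[nu]_y h (x, y))%E.
Proof.
move=> mh.
rewrite (_ : (fun x => _) =
    (fun x => \int[nu]_y (h^\+ (x, y)) - \int[nu]_y (h^\- (x, y))))%E; last first.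
  by apply/funext => x; rewrite integralE; congr (_ - _)%E;
    apply: eq_integral => y _; rewrite ?funeposE ?funenegE.
apply: emeasurable_funB.
  exact: (measurable_fun_fubini_tonelli_F (h^\+)%E (measurable_funepos mh)
    (fun z => funepos_ge0 h z)).
exact: (measurable_fun_fubini_tonelli_F (h^\-)%E (measurable_funeneg mh)
  (fun z => funeneg_ge0 h z)).
Qed.

Lemma Gamma_ge0 (R : realType) (a : R) : 0 <= Gamma a.
Proof.
by apply: Rintegral_ge0 => x _; rewrite mulr_ge0 ?powR_ge0 ?expR_ge0.
Qed.

(** * The Weyl operator: measurability and reduction to the kernel average *)

Section weyl_operator.
Variables (R : realType) (m : nat) (alpha : R) (f : 'I_m -> R -> R[i]).
Local Notation T := (measurableTypeR R).
Local Notation Rm := (m.-tuple T).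
Local Notation mu := (@lebesgue_measure R).
Local Notation leb := (lebesgue_tuple R m).
Hypothesis mf : forall i, cmeasurable [set: T] (f i).

Let g i x := Normc.normc (f i x).
Let g0 i x : 0 <= g i x. Proof. exact: normc_ge0. Qed.
Let mg i : measurable_fun [set: T] (g i).
Proof. exact: (measurable_normc (mf i)). Qed.

Let radial (z : T * Rm) : R :=
  (enorm (fun i => tnth z.2 i - z.1) `^ (m%:R - alpha))^-1 *
  \prod_(i < m) (tnth z.2 i)^-1.

Lemma weyl_integrandE x t : weyl_integrand alpha f x t =
  (\prod_(i < m) f i (tnth t i)) * real_complex R (radial (x, t)).
Proof.
by rewrite /weyl_integrand real_complexV -mulrA -rmorphM.
Qed.

Let mtnth i : measurable_fun [set: T * Rm] (fun z => tnth z.2 i : T).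
Proof. exact: (measurableT_comp (measurable_tnth i) measurable_snd). Qed.

Let mradial : measurable_fun setT radial.
Proof.
apply: measurable_funM.
  apply: (measurableT_comp (@measurable_invr R)).
  apply: (measurableT_comp (measurable_powR _)).
  apply: measurable_enorm => i; apply: measurable_funB; first exact: mtnth.
  exact: measurable_fst.
apply: measurable_prod => i _.
exact: (measurableT_comp (@measurable_invr R) (mtnth i)).
Qed.

Lemma cmeasurable_weyl_integrand :
  cmeasurable setT (fun z : T * Rm => weyl_integrand alpha f z.1 z.2).
Proof.
rewrite (_ : (fun z => _) = (fun z : T * Rm =>
    (\prod_(i < m) f i (tnth z.2 i)) * real_complex R (radial z))); last first.
  by apply/funext => -[x t]; rewrite weyl_integrandE.
apply: cmeasurableM; last exact: cmeasurable_real.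
apply: cmeasurable_prod => i; split.
  exact: (measurableT_comp (mf i).1 (mtnth i)).
exact: (measurableT_comp (mf i).2 (mtnth i)).
Qed.

Lemma cmeasurable_weyl_integrandx x :
  cmeasurable (@weyl_domain R m x : set Rm) (weyl_integrand alpha f x).
Proof.
have mpair : measurable_fun setT (fun t : Rm => (x, t) : T * Rm).
  by apply: measurable_fun_pair => //; exact: measurable_id.
split; apply: measurable_funTS.
  exact: (measurableT_comp cmeasurable_weyl_integrand.1 mpair).
exact: (measurableT_comp cmeasurable_weyl_integrand.2 mpair).
Qed.

(** The sections of [E] are the domains of integration. Its indicator replaces a domain that moves
    with x by a jointly measurable factor. *)
Let E : set (T * Rm) := [set z | forall i, z.1 < tnth z.2 i].

Let mE : measurable E.
Proof.
rewrite [X in measurable X](_ : _ =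
    \bigcap_(i in [set` 'I_m]) [set z : T * Rm | z.1 < tnth z.2 i]).
  apply: fin_bigcap_measurable => // i _.
  have mfst : measurable_fun setT (fst : T * Rm -> T) by exact: measurable_fst.
  have := measurable_fun_ltr mfst (mtnth i).
  by move=> /(_ measurableT [set true] I); rewrite setTI.
by apply/seteqP; split=> z /= h i => [_|]; exact: h.
Qed.

Let measurable_weyl_part (part : R[i] -> R) :
  measurable_fun setT (fun z : T * Rm => part (weyl_integrand alpha f z.1 z.2)) ->
  measurable_fun [set: T] (fun x =>
    \int[leb]_(t in weyl_domain x) part (weyl_integrand alpha f x t))%R.
Proof.
move=> mpart; rewrite /Rintegral.
apply: (measurableT_comp (@fine_measurable R _ measurableT)).
rewrite (_ : (fun x => _) = (fun x => \int[leb]_t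
    (\1_E (x, t) * part (weyl_integrand alpha f x t))%:E)%E); last first.
  apply/funext => x; rewrite integral_mkcond; apply: eq_integral => t _.
  rewrite patchE indicE (_ : (x, t) \in E = (t \in @weyl_domain R m x)).
    by case: ifP; rewrite ?mul1r ?mul0r.
  by apply/idP/idP; rewrite !inE.
apply: (@measurable_partial_integral _ _ _ _ _ leb (fun z : T * Rm =>
  (\1_E z * part (weyl_integrand alpha f z.1 z.2))%:E)).
by apply/measurable_EFinP; apply: measurable_funM.
Qed.

Lemma cmeasurable_weyl D : cmeasurable (D : set T) (weyl alpha f).
Proof.
rewrite (_ : weyl alpha f = (fun x =>
    cintegral leb (weyl_domain x) (weyl_integrand alpha f x) *
    real_complex R (Gamma alpha)^-1)); last first.
  by apply/funext => x; rewrite mulrC.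
apply: cmeasurableM; last by apply: cmeasurable_real.
split; apply: measurable_funTS.
  exact: (measurable_weyl_part cmeasurable_weyl_integrand.1).
exact: (measurable_weyl_part cmeasurable_weyl_integrand.2).
Qed.

(** The substitution t_i = x/s_i: for s_i > 0, x/s_i > x means s_i < 1, so the domain becomes the
    cube, and |x/s - x| = x |1/s - 1| produces the power of x. As an equality in the extended reals
    it serves three ends: the bound, almost everywhere convergence, and the exact evaluation at the
    extremal functions. *)
Lemma integral_normc_weyl_integrand x : 0 < x ->
  (\int[leb]_(t in weyl_domain x) (Normc.normc (weyl_integrand alpha f x t))%:E =
   (x `^ (alpha - m%:R))%:E * weyl_mean alpha g x)%E.
Proof.
move=> x0.
pose F (t : Rm) : R := \1_(@weyl_domain R m x) t * \prod_(i < m) g i (tnth t i) *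
  (enorm (fun i => tnth t i - x) `^ (m%:R - alpha))^-1.
have F0 t : 0 <= F t.
  by rewrite /F !mulr_ge0 ?invr_ge0 ?powR_ge0 ?prodr_ge0.
have mF : measurable_fun setT F.
  apply: measurable_funM.
    apply: measurable_funM; first by apply: measurable_indic; exact: measurable_weyl_domain.
    exact: measurable_prod_tnth.
  apply: (measurableT_comp (@measurable_invr R)).
  apply: (measurableT_comp (measurable_powR _)).
  apply: measurable_enorm => i; apply: measurable_funB => //.
  exact: measurable_tnthR.
transitivity (\int[leb]_t ((tuple_invpos t)%:E * (F t)%:E))%E.
  rewrite integral_mkcond; apply: eq_integral => t _.
  rewrite patchE /F indicE; case: ifPn => [|_]; last by rewrite !mul0r mule0.
  rewrite inE => Dt; rewrite mul1r -EFinM; congr EFin.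
  have t0 i : 0 < tnth t i by exact: lt_trans (Dt i).
  rewrite weyl_integrandE Normc.normcM normc_prod normc_real /radial/=.
  rewrite ger0_norm; last first.
    by rewrite mulr_ge0 ?invr_ge0 ?powR_ge0// prodr_ge0// => i _; rewrite invr_ge0 ltW.
  rewrite mulrA [RHS]mulrC; congr (_ * _).
  by apply: eq_bigr => i _; rewrite invposE.
have mFE : measurable_fun setT (EFin \o F) by exact/measurable_EFinP.
have FE0 t : (0 <= (EFin \o F) t)%E by rewrite lee_fin.
rewrite -(ge0_integral_tuple_scale_inv x0 mFE FE0).
rewrite -ge0_integralZl//; last 3 first.
- apply/measurable_EFinP; apply: measurable_funM; first exact: measurable_weyl_kernel.
  apply: measurable_prod => i _; apply: (measurableT_comp (mg i)).
  apply: measurable_funM => //.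
  exact: (measurableT_comp (@measurable_invr R) (measurable_tnth i)).
- by move=> s _; rewrite lee_fin mulr_ge0 ?weyl_kernel_ge0// prodr_ge0.
- by rewrite lee_fin powR_ge0.
apply: eq_integral => s _; rewrite -!EFinM; congr EFin => /=.
(* If some coordinate is not positive, both sides vanish: the left through [tuple_invpos], the right
   because the kernel is supported on the cube. *)
have [s0|] := pselect (forall i, 0 < tnth s i); last first.
  move/existsNP => [i /negP]; rewrite -leNgt => si.
  have ns : ~ unit_cube s by move=> /(_ i); rewrite ltNge si.
  rewrite weyl_kernel_out// mul0r mulr0 /tuple_invpos (bigD1 i)//=.
  by rewrite /invpos ltNge si !mul0r.
have DE : \1_(@weyl_domain R m x) (map_tuple (fun y => x / y) s) =
    \1_(@unit_cube R m) s :> R.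
  rewrite !indicE; congr (_%:R); apply: congr1.
  apply/idP/idP; rewrite !inE => h i; have := h i; rewrite tnth_map.
    by rewrite s0 ltr_pdivlMr// gtr_pMr.
  by rewrite s0 /= ltr_pdivlMr// gtr_pMr.
rewrite /F DE /weyl_kernel.
under [\prod_(i < m) g i (tnth (map_tuple _ _) _)]eq_bigr do rewrite tnth_map.
have -> : enorm (fun i => tnth (map_tuple (fun y => x / y) s) i - x) =
    x * enorm (fun i => (tnth s i)^-1 - 1).
  rewrite -enormZ ?(ltW x0)//; congr enorm; apply/funext => i.
  by rewrite tnth_map mulrBr mulr1.
rewrite powRM ?sqrtr_ge0 ?(ltW x0)// invfM -!powRN !opprB.
ring.
Qed.

Lemma normc_weyl_le x : 0 < x ->
  ((Normc.normc (weyl alpha f x))%:E <=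
   ((Gamma alpha)^-1 * x `^ (alpha - m%:R))%:E * weyl_mean alpha g x)%E.
Proof.
move=> x0.
have G0 : 0 <= (Gamma alpha)^-1 by rewrite invr_ge0 Gamma_ge0.
rewrite /weyl Normc.normcM normc_real ger0_norm// !EFinM -muleA.
rewrite lee_wpmul2l ?lee_fin// -integral_normc_weyl_integrand//.
apply: le_normc_cintegral; first exact: measurable_weyl_domain.
exact: cmeasurable_weyl_integrandx.
Qed.

End weyl_operator.

(** * Boundedness with the stated constant *)

Section weyl_bounded.
Variables (R : realType) (m : nat) (alpha p : R) (ps : 'I_m -> R).
Local Notation T := (measurableTypeR R).
Local Notation Rm := (m.-tuple T).
Local Notation mu := (@lebesgue_measure R).
Local Notation leb := (lebesgue_tuple R m).
Hypotheses (m0 : (0 < m)%N) (alpha0 : 0 < alpha) (alpham : alpha < m%:R).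
Hypotheses (p1 : 1 < p) (ps1 : forall i, 1 < ps i)
  (pps : p^-1 = \sum_(i < m) (ps i)^-1).

Let p0 : 0 < p. Proof. exact: lt_trans p1. Qed.
Let ps0 i : 0 < ps i. Proof. exact: lt_trans (ps1 i). Qed.

Lemma Lp_normE (q : R) (f : R -> R[i]) : 0 < q ->
  Lp_norm q f = ((\int[mu]_x ((Normc.normc (f x)) `^ q)%:E) `^ q^-1)%E.
Proof.
move=> q0; rewrite /Lp_norm unlock; congr (_ `^ _)%E.
by apply: eq_integral => x _ /=; rewrite ger0_norm ?normc_ge0.
Qed.

(** A positive slack [d] turns the norm of [f] into an admissible strictly positive bound even when
    [f] vanishes almost everywhere. *)
Lemma in_Lp_integral_le (q : R) (f : R -> R[i]) (d : R) : 0 < q -> 0 <= d ->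
  in_Lp q f ->
  (\int[mu]_x ((Normc.normc (f x)) `^ q)%:E <= ((fine (Lp_norm q f) + d) `^ q)%:E)%E.
Proof.
move=> q0 d0 [_ foo].
have N0 : (0 <= Lp_norm q f)%E by rewrite Lp_normE// poweR_ge0.
have I0 : (0 <= \int[mu]_x ((Normc.normc (f x)) `^ q)%:E)%E.
  by apply: integral_ge0 => x _; rewrite lee_fin powR_ge0.
apply: (@le_trans _ _ (Lp_norm q f `^ q)%E).
  by rewrite Lp_normE// -poweRrM mulVf ?gt_eqF// poweRe1.
move: foo N0; case: (Lp_norm q f) => [r| |]//= _; rewrite lee_fin => r0.
rewrite lee_fin; apply: ge0_ler_powR; rewrite ?nnegrE ?addr_ge0 ?(ltW q0)//.
by rewrite lerDl.
Qed.

Lemma cvg_prod_addr n (a : 'I_n -> R) :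
  (fun d : R => \prod_(i < n) (a i + d)) @ (0 : R) --> \prod_(i < n) a i.
Proof.
elim: n a => [|n IH] a.
  rewrite big_ord0; under eq_fun do rewrite big_ord0; exact: cvg_cst.
rewrite big_ord_recl; under eq_fun do rewrite big_ord_recl.
apply: cvgM; last exact: IH.
rewrite -[X in _ --> X]addr0; apply: cvgD; first exact: cvg_cst.
exact: cvg_id.
Qed.

(** The right-hand side is continuous in [d], so the slack can be sent to 0 from the right. *)
Lemma le_prod_addr n (a : 'I_n -> R) (c v : R) :
  (forall d, 0 < d -> v <= c * \prod_(i < n) (a i + d)) ->
  v <= c * \prod_(i < n) a i.
Proof.
move=> H.
have cv : (fun d : R => c * \prod_(i < n) (a i + d)) @ 0^'+ --> c * \prod_(i < n) a i.
  apply: cvg_at_right_filter; apply: cvgM; [exact: cvg_cst|exact: cvg_prod_addr].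
apply: (@cvgr_to_ge _ _ _ _ _ _ _ cv).
near=> d; apply: H.
by near: d; exact: nbhs_right_gt.
Unshelve. all: by end_near. Qed.

Section estimate.
Variables (f : 'I_m -> R -> R[i]) (N : 'I_m -> R).
Hypothesis mf : forall i, cmeasurable [set: T] (f i).
Hypothesis N0 : forall i, 0 < N i.
Hypothesis fN : forall i,
  (\int[mu]_x (Normc.normc (f i x) `^ ps i)%:E <= (N i `^ ps i)%:E)%E.

Let g i x := Normc.normc (f i x).

Let mean_bound := weyl_mean_bound m0 alpha0 alpham p1 ps1 pps
  (fun i => measurable_normc (mf i)) (fun i x => normc_ge0 (f i x)) N0 fN.

(** The p-th power of the mean of the |f_i| has a finite integral, so the mean is finite almost
    everywhere on the half-line. By the substitution formula this is absolute integrability of the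
    Weyl integrand at those x. *)
Lemma weyl_cintegrable_ae :
  {ae mu, forall x, 0 < x ->
     cintegrable leb (weyl_domain x) (weyl_integrand alpha f x)}.
Proof.
have mm : measurable_fun (`]0, +oo[%classic : set T)
    (fun x => weyl_mean alpha g x `^ p)%E.
  apply: measurable_funTS; apply: (measurableT_comp (measurable_poweR _)).
  apply: measurable_weyl_mean => [i|i x]; last exact: normc_ge0.
  exact: measurable_normc.
have fi : mu.-integrable `]0%R, +oo[ (fun x => weyl_mean alpha g x `^ p)%E.
  apply/integrableP; split => //.
  under eq_integral do rewrite gee0_abs ?poweR_ge0//.
  exact: le_lt_trans mean_bound (ltry _).
have mD : measurable (`]0, +oo[%classic : set T) by [].
have := integrable_ae mD fi.
apply: filterS => x /= H x0.
have : (weyl_mean alpha g x `^ p < +oo)%E.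
  by rewrite -ge0_fin_numE ?poweR_ge0//; apply: H; rewrite in_itv/= x0.
move/lty_poweRy => /(_ (lt0r_neq0 p0)) moo.
apply: cintegrable_normc; [exact: measurable_weyl_domain|
  exact: cmeasurable_weyl_integrandx|].
rewrite integral_normc_weyl_integrand//.
apply: lte_mul_pinfty => //; first by rewrite lee_fin powR_ge0.
Qed.

Lemma wLp_norm_weyl_le :
  (wLp_norm p (weyl_weight m alpha p) (weyl alpha f) <=
   (weyl_const alpha ps * \prod_(i < m) N i)%:E)%E.
Proof.
have G0 : 0 <= (Gamma alpha)^-1 by rewrite invr_ge0 Gamma_ge0.
set G := (Gamma alpha)^-1 in G0 *.
rewrite weyl_constE -/G.
set A := fine _.
have A0 : 0 <= A.
  apply/fine_ge0/integral_ge0 => s _.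
  by rewrite lee_fin mulr_ge0 ?weyl_kernel_ge0 ?prod_powR_ge0.
have P0 : 0 <= \prod_(i < m) N i by rewrite prodr_ge0// => i _; exact: ltW.
have mg i : measurable_fun [set: T] (g i) by exact: measurable_normc.
have g0 i x : 0 <= g i x by exact: normc_ge0.
have nn (z : \bar R) : (0 <= z)%E -> z \in `[0%E, +oo%E].
  by move=> z0; rewrite in_itv/= z0 leey.
have mmean : measurable_fun (`]0, +oo[%classic : set T)
    (fun x => weyl_mean alpha g x `^ p)%E.
  apply: measurable_funTS; apply: (measurableT_comp (measurable_poweR _)).
  exact: measurable_weyl_mean.
apply: (@le_trans _ _ (((G * A * \prod_(i < m) N i) `^ p)%:E `^ p^-1)%E); last first.
  by rewrite poweR_EFin -powRrM divff ?gt_eqF// powRr1 ?mulr_ge0.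
apply: gt0_ler_poweR; first by rewrite invr_ge0 ltW.
- apply: nn; apply: integral_ge0 => x _.
  by rewrite lee_fin mulr_ge0 ?powR_ge0.
- by apply: nn; rewrite lee_fin powR_ge0.
apply: (@le_trans _ _ (\int[mu]_(x in `]0%R, +oo[)
    ((G `^ p)%:E * weyl_mean alpha g x `^ p))%E).
  apply: ge0_le_integral => //.
  - by move=> x _; rewrite lee_fin mulr_ge0 ?powR_ge0.
  - apply/measurable_EFinP; apply: measurable_funM.
      apply: (measurableT_comp (measurable_powR _)).
      by apply: (measurable_normc (cmeasurable_weyl alpha mf _)).
    by apply: measurable_funTS; exact: measurable_powR.
  - exact: measurable_funeM.
  move=> x Dx; have x0 : 0 < x by move: Dx; rewrite /= in_itv/= andbT.
  (* The weight is the exact inverse of the p-th power of the scaling factor, which leaves the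
     unweighted mean. *)
  have xw : (x `^ (alpha - m%:R)) `^ p * weyl_weight m alpha p x = 1.
    rewrite /weyl_weight -powRrM -powRD ?(gt_eqF x0) ?implybT//.
    by rewrite (_ : _ + _ = 0) ?powRr0//; ring.
  rewrite EFinM.
  apply: (@le_trans _ _ ((((G * x `^ (alpha - m%:R))%:E * weyl_mean alpha g x) `^ p) *
      (weyl_weight m alpha p x)%:E)%E).
    rewrite lee_wpmul2r ?lee_fin ?powR_ge0//.
    rewrite -poweR_EFin; apply: gt0_ler_poweR; first exact: ltW.
    - by apply: nn; rewrite lee_fin normc_ge0.
    - by apply: nn; rewrite mule_ge0 ?weyl_mean_ge0// lee_fin mulr_ge0 ?powR_ge0.
    - exact: normc_weyl_le.
  rewrite poweRM ?weyl_mean_ge0 ?lee_fin ?mulr_ge0 ?powR_ge0//.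
  rewrite poweR_EFin powRM ?powR_ge0// muleAC -EFinM -mulrA xw mulr1 //.
rewrite ge0_integralZl//; last 2 first.
- by move=> x _; exact: poweR_ge0.
- by rewrite lee_fin powR_ge0.
apply: (@le_trans _ _ ((G `^ p)%:E * (A `^ p * (\prod_(i < m) N i) `^ p)%:E)%E).
  by rewrite lee_wpmul2l ?lee_fin ?powR_ge0//; exact: mean_bound.
by rewrite -EFinM lee_fin !powRM ?mulr_ge0// mulrA.
Qed.

End estimate.

Lemma weyl_is_bound : is_bound ps p (weyl_weight m alpha p) (@weyl R m alpha)
  (weyl_const alpha ps).
Proof.
move=> f fL.
have n0 i : (0 <= Lp_norm (ps i) (f i))%E by rewrite Lp_normE ?poweR_ge0.
have nfin i : Lp_norm (ps i) (f i) \is a fin_num.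
  by rewrite ge0_fin_numE//; have [] := fL i.
have wle d : 0 < d -> (wLp_norm p (weyl_weight m alpha p) (weyl alpha f) <=
    (weyl_const alpha ps * \prod_(i < m) (fine (Lp_norm (ps i) (f i)) + d))%:E)%E.
  move=> d0; apply: wLp_norm_weyl_le => i.
  - by have [] := fL i.
  - by rewrite ltr_wpDl ?fine_ge0.
  - by apply: in_Lp_integral_le => //; exact: ltW.
have w0 : (0 <= wLp_norm p (weyl_weight m alpha p) (weyl alpha f))%E.
  exact: poweR_ge0.
(* Slack 1 already shows that the left side is finite, so the passage to the limit can take place in
   the reals. *)
have wfin : wLp_norm p (weyl_weight m alpha p) (weyl alpha f) \is a fin_num.
  by rewrite ge0_fin_numE// (le_lt_trans (wle _ ltr01))// ltry.
rewrite (eq_bigr (fun i => (fine (Lp_norm (ps i) (f i)))%:E)); last first.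
  by move=> i _; rewrite fineK.
rewrite -(fineK wfin) prodEFin -EFinM lee_fin.
by apply: le_prod_addr => d d0; rewrite -lee_fin fineK// wle.
Qed.

End weyl_bounded.

(** * Optimality of the constant *)

Section sharpness.
Variables (R : realType) (m : nat) (alpha p : R) (ps : 'I_m -> R).
Local Notation T := (measurableTypeR R).
Local Notation Rm := (m.-tuple T).
Local Notation mu := (@lebesgue_measure R).
Local Notation leb := (lebesgue_tuple R m).
Hypotheses (m0 : (0 < m)%N) (alpha0 : 0 < alpha) (alpham : alpha < m%:R).
Hypotheses (p1 : 1 < p) (ps1 : forall i, 1 < ps i)
  (pps : p^-1 = \sum_(i < m) (ps i)^-1).

Let p0 : 0 < p. Proof. exact: lt_trans p1. Qed.
Let ps0 i : 0 < ps i. Proof. exact: lt_trans (ps1 i). Qed.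

(** For nonnegative functions the integrand is real and nonnegative on its domain, so the triangle
    inequality for the integral loses nothing. *)
Lemma normc_weyl_real (g : 'I_m -> R -> R) x : (forall i y, 0 <= g i y) -> 0 < x ->
  Normc.normc (weyl alpha (fun i y => real_complex R (g i y)) x) =
  (Gamma alpha)^-1 * fine (\int[leb]_(t in weyl_domain x)
    (Normc.normc (weyl_integrand alpha (fun i y => real_complex R (g i y)) x t))%:E)%E.
Proof.
move=> g0 x0; rewrite /weyl.
set F := weyl_integrand _ _ _.
pose r (t : Rm) := \prod_(i < m) g i (tnth t i) *
  ((enorm (fun i => tnth t i - x) `^ (m%:R - alpha))^-1 * \prod_(i < m) (tnth t i)^-1).
have FE t : F t = real_complex R (r t).
  by rewrite /F weyl_integrandE -rmorph_prod -rmorphM.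
have r0 t : weyl_domain x t -> 0 <= r t.
  move=> Dt; rewrite /r !mulr_ge0 ?invr_ge0 ?powR_ge0 ?prodr_ge0// => i _.
  by rewrite invr_ge0 ltW// (lt_trans x0 (Dt i)).
have G0 : 0 <= (Gamma alpha)^-1 by rewrite invr_ge0 Gamma_ge0.
have -> : cintegral leb (weyl_domain x) F =
    real_complex R (fine (\int[leb]_(t in weyl_domain x) (Normc.normc (F t))%:E)%E).
  rewrite /cintegral; congr Complex.
    apply: eq_Rintegral => t; rewrite inE => Dt.
    by rewrite FE normc_real ger0_norm// r0.
  rewrite (@eq_Rintegral _ _ _ leb _ (fun=> 0)).
    by rewrite /Rintegral integral0.
  by move=> t _; rewrite FE.
rewrite -rmorphM normc_real ger0_norm// mulr_ge0// fine_ge0// integral_ge0// => t _.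
by rewrite lee_fin normc_ge0.
Qed.

Section extremal.
Variable e : R.
Hypothesis e0 : 0 < e.

Let c i := (1 + e) / ps i.
(** The p_i-th power of [g i] is x^(-1 - e) on [1, oo), with integral 1/e. Hence the product of the
    norms is e^(-1/p), which blows up as e tends to 0. *)
Let g (i : 'I_m) (x : R) : R := \1_(`[1, +oo[%classic : set R) x * x `^ (- c i).
Let f (i : 'I_m) (x : R) : R[i] := real_complex R (g i x).

Let g0 i x : 0 <= g i x. Proof. by rewrite mulr_ge0 ?powR_ge0. Qed.

Let c0 i : 0 < c i. Proof. by rewrite divr_gt0// addr_gt0. Qed.

Let mg i : measurable_fun [set: T] (g i).
Proof.
by apply: measurable_funM; [exact: measurable_indic|exact: measurable_powR].
Qed.

Let mf i : cmeasurable [set: T] (f i).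
Proof. exact: (cmeasurable_real (mg i)). Qed.

Let Lp_norm_extremal i : Lp_norm (ps i) (f i) = ((e^-1) `^ (ps i)^-1)%:E.
Proof.
rewrite Lp_normE// -poweR_EFin -integral_powR_1y//; congr (_ `^ _)%E.
rewrite [RHS]integral_mkcond; apply: eq_integral => x _.
rewrite /f normc_real ger0_norm// /g patchE mem_setE itv_indicE.
case: ifPn => _; last by rewrite mul0r powR0// gt_eqF.
rewrite mul1r -powRrM; congr (_ `^ _)%:E.
by rewrite /c; field; rewrite gt_eqF.
Qed.

Let in_Lp_extremal i : in_Lp (ps i) (f i).
Proof. by split; rewrite ?Lp_norm_extremal ?ltry. Qed.

Let prod_Lp_norm_extremal :
  (\prod_(i < m) Lp_norm (ps i) (f i))%E = ((e^-1) `^ p^-1)%:E.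
Proof.
under eq_bigr do rewrite Lp_norm_extremal.
by rewrite prodEFin prod_powR_sum ?invr_gt0// pps.
Qed.

Let A := fine (\int[leb]_s (weyl_kernel alpha s * \prod_(i < m) tnth s i `^ c i)%:E)%E.

Let AE : (\int[leb]_s (weyl_kernel alpha s * \prod_(i < m) tnth s i `^ c i)%:E)%E = A%:E.
Proof.
rewrite /A fineK// ge0_fin_numE; first exact: weyl_kernel_lty.
by apply: integral_ge0 => s _; rewrite lee_fin mulr_ge0 ?weyl_kernel_ge0 ?prod_powR_ge0.
Qed.

Let A0 : 0 <= A.
Proof.
rewrite -lee_fin -AE; apply: integral_ge0 => s _.
by rewrite lee_fin mulr_ge0 ?weyl_kernel_ge0 ?prod_powR_ge0.
Qed.

(** For x >= 1 and s in the cube every x/s_i exceeds 1, so the cut-off is inactive and the power of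
    x factors out of each g_i; the exponents add up to -(1 + e)/p. *)
Let weyl_mean_extremal x : 1 <= x ->
  weyl_mean alpha g x = (x `^ (- ((1 + e) / p)) * A)%:E.
Proof.
move=> x1; have x0 : 0 < x by exact: lt_le_trans x1.
rewrite EFinM -AE -ge0_integralZl//; last 3 first.
- apply/measurable_EFinP; apply: measurable_funM.
    exact: measurable_weyl_kernel.
  exact: measurable_prod_powR.
- by move=> s _; rewrite lee_fin mulr_ge0 ?weyl_kernel_ge0 ?prod_powR_ge0.
- by rewrite lee_fin powR_ge0.
apply: eq_integral => s _; rewrite -EFinM; congr EFin.
have [cs|cs] := pselect (unit_cube s); last first.
  by rewrite weyl_kernel_out// !(mul0r, mulr0).
rewrite mulrCA; congr (_ * _).
have -> : - ((1 + e) / p) = \sum_(i < m) - c i.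
  by rewrite sumrN pps mulr_sumr.
rewrite -prod_powR_sum// -big_split/=; apply: eq_bigr => i _.
have /andP[s0 s1] := cs i.
rewrite /g itv_indicE in_itv/= andbT.
have -> : 1 <= x / tnth s i.
  by rewrite ler_pdivlMr// mul1r (le_trans (ltW s1)).
rewrite mul1r powRM ?invr_ge0 ?(ltW x0) ?(ltW s0)//; congr (_ * _).
by rewrite -powR_inv1 ?(ltW s0)// -powRrM mulN1r opprK.
Qed.

(** On [1, oo) the integrand of the weighted norm is exactly (A / Gamma(alpha))^p x^(-1 - e),
    because the weight cancels the scaling power. Its integral contributes e^(-1/p) to the norm, the
    same factor as the product of the norms of the f_i, and the two cancel. *)
Lemma le_extremal_bound (C : R) :
  is_bound ps p (weyl_weight m alpha p) (@weyl R m alpha) C ->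
  (Gamma alpha)^-1 *
  fine (\int[leb]_s (weyl_kernel alpha s * \prod_(i < m) tnth s i `^ ((1 + e) / ps i))%:E)%E
  <= C.
Proof.
move=> /(_ f in_Lp_extremal); rewrite prod_Lp_norm_extremal -/A.
have G0 : 0 <= (Gamma alpha)^-1 by rewrite invr_ge0 Gamma_ge0.
set G := (Gamma alpha)^-1 in G0 *.
have nn (z : \bar R) : (0 <= z)%E -> z \in `[0%E, +oo%E].
  by move=> z0; rewrite in_itv/= z0 leey.
have K0 : 0 < e^-1 `^ p^-1 by rewrite powR_gt0// invr_gt0.
move=> H; rewrite -(ler_pM2r K0) -lee_fin (EFinM C).
apply: le_trans H.
rewrite /wLp_norm.
have -> : (G * A * e^-1 `^ p^-1)%:E = (((G * A) `^ p * e^-1)%:E `^ p^-1)%E.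
  rewrite poweR_EFin powRM ?powR_ge0 ?invr_ge0 ?(ltW e0)//.
  by rewrite -powRrM divff ?gt_eqF// powRr1 ?mulr_ge0.
apply: gt0_ler_poweR; first by rewrite invr_ge0 ltW.
- by apply: nn; rewrite lee_fin mulr_ge0 ?powR_ge0 ?invr_ge0 ?(ltW e0).
- by apply: nn; apply: integral_ge0 => x _; rewrite lee_fin mulr_ge0 ?powR_ge0.
have mh D : measurable_fun (D : set T)
    (fun x => (Normc.normc (weyl alpha f x) `^ p * weyl_weight m alpha p x)%:E).
  apply/measurable_EFinP; apply: measurable_funM.
    apply: (measurableT_comp (measurable_powR _)).
    by apply: (measurable_normc (cmeasurable_weyl alpha mf _)).
  by apply: measurable_funTS; exact: measurable_powR.
(* A lower bound is enough, so the part over (0, 1), where the truncation matters, is discarded. *)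
apply: (@le_trans _ _ (\int[mu]_(x in `[1%R, +oo[)
    (Normc.normc (weyl alpha f x) `^ p * weyl_weight m alpha p x)%:E)%E); last first.
  apply: ge0_subset_integral => //.
    by move=> x _; rewrite lee_fin mulr_ge0 ?powR_ge0.
  move=> x /=; rewrite !in_itv/= !andbT; exact: lt_le_trans.
rewrite EFinM -integral_powR_1y// -ge0_integralZl//; last 3 first.
- apply: measurable_funTS; apply/measurable_EFinP; exact: measurable_powR.
- by move=> x _; rewrite lee_fin powR_ge0.
- by rewrite lee_fin powR_ge0.
rewrite le_eqVlt; apply/orP; left; apply/eqP; apply: eq_integral => x /set_mem xD.
have x1 : 1 <= x by move: xD; rewrite /= in_itv/= andbT.
have x0 : 0 < x by exact: lt_le_trans x1.
rewrite (normc_weyl_real g0 x0) (integral_normc_weyl_integrand alpha mf x0).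
rewrite [weyl_mean _ _ _](_ : _ = weyl_mean alpha g x); last first.
  apply: eq_integral => s _; congr (_ * _)%:E; apply: eq_bigr => i _.
  by rewrite normc_real ger0_norm.
rewrite weyl_mean_extremal// -EFinM [fine _]/= -/G; congr EFin; apply/esym.
rewrite /weyl_weight (_ : G * _ = G * A * x `^ (alpha - m%:R - (1 + e) / p)); last first.
  by rewrite (@powRD _ x (alpha - m%:R)) ?(gt_eqF x0) ?implybT//; ring.
rewrite powRM ?mulr_ge0 ?powR_ge0// -mulrA -powRrM; congr (_ * _).
rewrite -powRD ?(gt_eqF x0) ?implybT//; congr (_ `^ _).
by field; rewrite gt_eqF.
Qed.

End extremal.

Lemma weyl_const_le (C : R) :
  is_bound ps p (weyl_weight m alpha p) (@weyl R m alpha) C ->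
  weyl_const alpha ps <= C.
Proof.
move=> bC; rewrite weyl_constE.
pose e (k : nat) : R := k.+1%:R^-1.
have e0 k : 0 < e k by rewrite invr_gt0.
pose a (b : R) (s : Rm) : \bar R :=
  (weyl_kernel alpha s * \prod_(i < m) tnth s i `^ (b / ps i))%:E.
have ma b : measurable_fun setT (a b).
  apply/measurable_EFinP; apply: measurable_funM.
    exact: measurable_weyl_kernel.
  exact: measurable_prod_powR.
have a0 b s : (0 <= a b s)%E.
  by rewrite lee_fin mulr_ge0 ?weyl_kernel_ge0 ?prod_powR_ge0.
have cva s : a (1 + e k) s @[k --> \oo] --> a 1 s.
  have [cs|cs] := pselect (unit_cube s); last first.
    rewrite /a; under eq_fun do rewrite weyl_kernel_out// mul0r.
    rewrite weyl_kernel_out// mul0r; exact: cvg_cst.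
  pose q := \prod_(i < m) tnth s i `^ (ps i)^-1.
  have q0 : 0 < q.
    by apply: prodr_gt0 => i _; rewrite powR_gt0//; have /andP[] := cs i.
  (* The whole product is the power [b] of the single positive number [q], so convergence in [b] is
     continuity of the exponential. *)
  have qE b : \prod_(i < m) tnth s i `^ (b / ps i) = expR (b * ln q).
    transitivity (q `^ b); last by rewrite /powR gt_eqF.
    rewrite powR_prod; last by move=> i; exact: powR_ge0.
    by apply: eq_bigr => i _; rewrite -powRrM mulrC.
  rewrite /a; apply: cvg_EFin; first by near=> k.
  rewrite /comp/=; under eq_fun do rewrite qE; rewrite qE.
  apply: cvgM; first exact: cvg_cst.
  have H : (1 + e k) * ln q @[k --> \oo] --> 1 * ln q.
    apply: cvgM; last exact: cvg_cst.
    rewrite -[X in _ --> X](addr0 1); apply: cvgD; first exact: cvg_cst.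
    exact: cvg_harmonic.
  exact: (cvg_comp _ _ H (@continuous_expR R _)).
(* The coordinates are below 1, so their powers increase as the exponents (1 + e_k)/p_i decrease;
   this permits monotone convergence. *)
have nda s : {homo (fun k => a (1 + e k) s) : k l / (k <= l)%N >-> (k <= l)%E}.
  move=> k l kl; have [cs|cs] := pselect (unit_cube s); last first.
    by rewrite /a weyl_kernel_out// !mul0r.
  rewrite lee_fin ler_wpM2l ?weyl_kernel_ge0//.
  apply: ler_prod => i _; rewrite powR_ge0/=.
  have /andP[s0 s1] := cs i.
  apply: ger_powR; first by rewrite s0 ltW.
  rewrite ler_pM2r ?invr_gt0// lerD2l lef_pV2 ?posrE// ler_nat ltnS //.
have cvI : (\int[leb]_s a (1 + e k)%R s)%E @[k --> \oo] --> (\int[leb]_s a 1%R s)%E.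
  rewrite [X in _ --> X](eq_integral (fun s => limn (fun k => a (1 + e k)%R s))); last first.
    by move=> s _; apply/esym/cvg_lim.
  by apply: cvg_monotone_convergence => // s _ k l; exact: nda.
have Ifin : (\int[leb]_s a 1%R s)%E \is a fin_num.
  rewrite ge0_fin_numE; last exact: integral_ge0.
  by apply: weyl_kernel_lty => // i; rewrite divr_gt0.
rewrite (eq_integral (a 1)); last first.
  by move=> s _; rewrite /a; under [in RHS]eq_bigr do rewrite mul1r.
have cvF : (Gamma alpha)^-1 * fine (\int[leb]_s a (1 + e k)%R s)%E @[k --> \oo] -->
    (Gamma alpha)^-1 * fine (\int[leb]_s a 1%R s)%E.
  apply: cvgM; first exact: cvg_cst.
  by apply: fine_cvg; rewrite fineK.
apply: (@cvgr_to_le _ _ _ _ _ _ _ cvF).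
near=> k; exact: le_extremal_bound.
Unshelve. all: by end_near. Qed.

End sharpness.

Theorem corollary4p1 (R : realType) (m : nat) (alpha p : R) (ps : 'I_m -> R)
    (hm : (2 <= m)%N) (halpha0 : 0 < alpha) (halpham : alpha < m%:R)
    (hp : 1 < p) (hps : forall i, 1 < ps i)
    (hpps : p^-1 = \sum_(i < m) (ps i)^-1) :
  [/\ forall f : 'I_m -> R -> R[i], (forall i, in_Lp (ps i) (f i)) ->
        {ae @lebesgue_measure R, forall x, 0 < x ->
           cintegrable (lebesgue_tuple R m) (@weyl_domain R m x)
             (weyl_integrand alpha f x)} /\
        in_wLp p (weyl_weight m alpha p) (weyl alpha f),
      (lebesgue_tuple R m).-integrable (@unit_cube R m)
        (fun t => (weyl_const_integrand alpha ps t)%:E)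
    & is_operator_norm ps p (weyl_weight m alpha p) (@weyl R m alpha)
        (weyl_const alpha ps)].
Proof.
have m0 : (0 < m)%N by exact: ltnW.
have ps0 i : 0 < ps i by exact: lt_trans (hps i).
have bounded := weyl_is_bound m0 halpha0 halpham hp hps hpps.
split; last by split=> // C; exact: weyl_const_le.
- move=> f fL; split.
    (* Only finite positive bounds on the norms are wanted here, hence the added 1. *)
    apply: (weyl_cintegrable_ae m0 halpha0 halpham hp hps hpps
      (N := fun i => fine (Lp_norm (ps i) (f i)) + 1)) => i.
    + by have [] := fL i.
    + by rewrite ltr_wpDl// fine_ge0// Lp_normE// poweR_ge0.
    + exact: in_Lp_integral_le.
  split.
    by apply: cmeasurable_weyl => i; have [] := fL i.
  apply: le_lt_trans (bounded f fL) _; rewrite ltey_eq; apply/orP; left.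
  rewrite fin_numM//; elim/big_ind : _ => // [x y|i _]; first exact: fin_numM.
  by rewrite ge0_fin_numE ?Lp_normE ?poweR_ge0// -Lp_normE//; have [] := fL i.
- exact: weyl_const_integrable.
Qed.
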